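(* Fix an integer $s\ge 0$. For all integers $k\ge 0$ and $n\ge 1$ define $\omega^{n,k,s}\in\mathbb{Q}V_{\mathrm{conn}}^{n,k,s}$ by the following recursion: (i) $\omega^{1,0,s}$ is the graph consisting of a single vertex with $s$ external edges whose free ends are labeled $x_1,\dots,x_s$, with coefficient $1$; (ii) for $(n,k)\neq(1,0)$, $$\omega^{n,k,s}:=\frac{1}{k+n-1}\left(\sum_{i=1}^{n-1}q_i^{(1)}(\omega^{n-1,k,s})+\frac12\sum_{i=1}^{n}t_i(\omega^{n,k-1,s})\right),$$ where the first sum is empty when $n=1$ and the $t_i$ summand does not appear when $k=0$. Then, for all fixed $n$ and $k$, $\omega^{n,k,s}=\sum_{G\in V_{\mathrm{conn}}^{n,k,s}}\alpha_G\,G$ with $\alpha_G\in\mathbb{Q}$ and $\alpha_G>0$ for all $G\in V_{\mathrm{conn}}^{n,k,s}$. Moreover, for every isomorphism class $\mathscr{C}\subseteq V_{\mathrm{conn}}^{n,k,s}$, $$\sum_{G\in\mathscr{C}}\alpha_G=\frac{1}{S^{\mathscr{C}}},$$ where $S^{\mathscr{C}}$ denotes the symmetry factor of the graphs in $\mathscr{C}$.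
   Context: Graphs. A graph consists of a finite nonempty set $V$ of vertices, a finite set $K$ of ends of edges, and a partition $E$ of $K$ into two-element subsets, called edges; $E=E_{\mathrm{int}}\sqcup E_{\mathrm{ext}}$. Each end of an internal edge (element of $E_{\mathrm{int}}$) is assigned to a vertex; for each external edge (element of $E_{\mathrm{ext}}$) one end is assigned to a vertex and the other end is free. If there are $s$ external edges, their free ends carry distinct labels $x_1,\dots,x_s$. An internal edge with both ends assigned to the same vertex is a loop. Multiple edges and loops are allowed. A graph is connected if any two distinct vertices are joined by a path of internal edges (a single vertex is connected). The cyclomatic number is $k=m-n+c$, where $m=|E_{\mathrm{int}}|$, $n=|V|$ and $c$ is the number of connected components. Isomorphisms. An isomorphism of graphs is a pair of bijections $\psi_V:V\to V^*$, $\psi_K:K\to K^*$ that maps internal edges to internal edges and external edges to external edges, respects the assignment of ends to vertices (and free ends), and preserves the labels of the external edges. The symmetry factor $S^G$ is the order of the group of automorphisms $(\psi_V,\psi_K)$ of $G$; it is constant on isomorphism classes. Sets of graphs. $V^{n,k,s}$ is the set of all graphs with vertex set $\{v_1,\dots,v_n\}$, cyclomatic number $k$, and $s$ external edges whose free ends are labeled $x_1,\dots,x_s$; the vertices are ordered (labeled), while graphs that differ only by renaming the ends of edges (i.e. that are isomorphic via some $(\psi_V,\psi_K)$ with $\psi_V=\mathrm{id}$) are identified. $V_{\mathrm{conn}}^{n,k,s}\subseteq V^{n,k,s}$ is the subset of connected graphs. An isomorphism class $\mathscr{C}\subseteq V_{\mathrm{conn}}^{n,k,s}$ is an equivalence class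 under isomorphism, where $\psi_V$ may permute $v_1,\dots,v_n$. For a set $W$, $\mathbb{Q}W$ is the free $\mathbb{Q}$-vector space on $W$. Linear maps, defined on graphs $G\in V^{n,k,s}$ and extended linearly: - $t_i(G)$, $1\le i\le n$, is $G$ with one additional loop at $v_i$. - $l_{i,j}(G)$, $i\ne j$, is $G$ with one additional internal edge joining $v_i$ and $v_j$. - $s_i(G)$, $1\le i\le n$: let $\mathcal{E}_i$ be the set of all ends (of internal and external edges) assigned to $v_i$. Then $s_i(G)=\sum G_{(\mathcal{E}^{(1)},\mathcal{E}^{(2)})}$, the sum being over all ordered pairs of disjoint, possibly empty sets with $\mathcal{E}^{(1)}\cup\mathcal{E}^{(2)}=\mathcal{E}_i$, where $G_{(\mathcal{E}^{(1)},\mathcal{E}^{(2)})}$ is obtained from $G$ by adding a new vertex $v_{n+1}$, keeping the ends in $\mathcal{E}^{(1)}$ at $v_i$, and reassigning the ends in $\mathcal{E}^{(2)}$ to $v_{n+1}$. - $q_i^{(1)}:=\frac12\, l_{i,n+1}\circ s_i:\mathbb{Q}V^{n,k,s}\to\mathbb{Q}V^{n+1,k,s}$. *)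

(* Defs.v *)
From HB Require Import structures.
From mathcomp Require Import all_boot all_order all_algebra.
From mathcomp Require Import finmap.
From mathcomp.multinomials Require Import monalg.

Set Implicit Arguments.
Unset Strict Implicit.
Unset Printing Implicit Defensive.

Import GRing.Theory.
Local Open Scope quotient_scope.
Local Open Scope ring_scope.

Section Graphs.
Variable s : nat.

(* The internal edges, the external edges (both as sets of two ends) and the
   attachment of the ends: [inl v] is an end assigned to the vertex [v], and
   [inr j] is the free end carrying the label x_(j+1). *)
Definition graph_data (V K : finType) : Type :=
  ({set {set K}} * {set {set K}} * {ffun K -> V + 'I_s})%type.

Definition graph_valid (V K : finType) (d : graph_data V K) : bool :=
  let: (eint, eext, att) := d in
  [&& partition (eint :|: eext) [set: K],
      [disjoint eint & eext],
      [forall e in eint :|: eext, #|e| == 2],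
      [forall e in eint, forall x in e, is_inl (att x)],
      [forall e in eext, #|[set x in e | ~~ is_inl (att x)]| == 1]
    & [forall j : 'I_s, #|[set x | att x == inr j]| == 1]].

(* The nonemptiness of the vertex set is not imposed here. *)
Record graph (V K : finType) :=
  Graph { gval :> graph_data V K; _ : graph_valid gval }.

HB.instance Definition _ V K := [isSub for @gval V K].
HB.instance Definition _ V K := [Countable of graph V K by <:].

Definition eint V K (G : graph V K) : {set {set K}} := (gval G).1.1.
Definition eext V K (G : graph V K) : {set {set K}} := (gval G).1.2.
Definition att V K (G : graph V K) : K -> V + 'I_s := (gval G).2.

Definition ends_at V K (G : graph V K) (v : V) : {set K} :=
  [set x | att G x == inl v].

Definition move_vertex (V V' : Type) (f : V -> V') (u : V + 'I_s) : V' + 'I_s :=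
  match u with inl v => inl (f v) | inr j => inr j end.

Definition bij (A B : finType) (f : {ffun A -> B}) : bool :=
  injectiveb f && [forall b, b \in codom f].

Definition is_iso (V V' K K' : finType) (G : graph V K) (G' : graph V' K')
    (psiV : {ffun V -> V'}) (psiK : {ffun K -> K'}) : bool :=
  [&& bij psiV, bij psiK,
      [set psiK @: (e : {set K}) | e in eint G] == eint G',
      [set psiK @: (e : {set K}) | e in eext G] == eext G'
    & [forall x, att G' (psiK x) == move_vertex psiV (att G x)]].

Definition isomorphic (V V' K K' : finType)
    (G : graph V K) (G' : graph V' K') : bool :=
  [exists psiV, exists psiK, is_iso G G' psiV psiK].

Definition symmetry_factor (V K : finType) (G : graph V K) : nat :=
  #|[set psi : {ffun V -> V} * {ffun K -> K} | is_iso G G psi.1 psi.2]|.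

Definition same_up_to_ends (V K K' : finType)
    (G : graph V K) (G' : graph V K') : bool :=
  [exists psiK, is_iso G G' [ffun v => v] psiK].

Definition adjacent (V K : finType) (G : graph V K) : rel V :=
  fun v w => [exists e in eint G, exists x in e, exists y in e,
    [&& x != y, att G x == inl v & att G y == inl w]].

Definition connected (V K : finType) (G : graph V K) : bool :=
  [forall v, forall w, connect (adjacent G) v w].

(* k = m - n + c, written without subtraction. *)
Definition has_cyclomatic (V K : finType) (G : graph V K) (k : nat) : bool :=
  (k + #|V| == #|eint G| + n_comp (adjacent G) V)%N.

Lemma graph_validP (V K : finType) (d : graph_data V K) :
  reflect
    [/\ partition (d.1.1 :|: d.1.2) [set: K], [disjoint d.1.1 & d.1.2],
        (forall e, e \in d.1.1 :|: d.1.2 -> #|e| = 2),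
        (forall e x, e \in d.1.1 -> x \in e -> is_inl (d.2 x))
      & (forall e, e \in d.1.2 -> #|[set x in e | ~~ is_inl (d.2 x)]| = 1) /\
        (forall j, #|[set x | d.2 x == inr j]| = 1)]
    (graph_valid d).
Proof.
case: d => [[ei ee] at_] /=; apply: (iffP and5P).
  case=> -> -> /forall_inP h1 /forall_inP h2 /andP[/forall_inP h3 /forallP h4].
  split=> //; first by move=> e /h1/eqP.
    by move=> e x /h2/forall_inP; apply.
  by split=> [e /h3/eqP|j] //; apply/eqP.
case=> -> -> h1 h2 [h3 h4]; split=> //.
- by apply/forall_inP=> e /h1 ->.
- by apply/forall_inP=> e he; apply/forall_inP=> x; apply: h2.
- by apply/andP; split; [apply/forall_inP=> e /h3 ->|apply/forallP=> j; rewrite h4].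
Qed.


Lemma bijP (A B : finType) (f : {ffun A -> B}) :
  reflect (exists g : {ffun B -> A}, cancel f g /\ cancel g f) (bij f).
Proof.
apply: (iffP andP) => [[/injectiveP f_inj /forallP f_onto]|[g [fK gK]]].
  exists [ffun b => iinv (f_onto b)]; split=> x; last by rewrite ffunE f_iinv.
  by apply: f_inj; rewrite ffunE f_iinv.
split; first by apply/injectiveP; apply: can_inj fK.
by apply/forallP=> b; rewrite -[b]gK codom_f.
Qed.

Lemma is_iso_refl (V K : finType) (G : graph V K) :
  is_iso G G [ffun v => v] [ffun x => x].
Proof.
have bij_id (A : finType) : bij [ffun a : A => a].
  by apply/bijP; exists [ffun a => a]; split=> a; rewrite !ffunE.
have im_id (P : {set {set K}}) :
    [set [ffun x => x] @: (e : {set K}) | e in P] = P.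
  rewrite -[RHS]imset_id; apply: eq_imset => e.
  by rewrite -[RHS]imset_id; apply: eq_imset => x; rewrite ffunE.
rewrite /is_iso !bij_id !im_id !eqxx /=; apply/forallP=> x.
by rewrite ffunE; case: (att G x) => //= v; rewrite ffunE.
Qed.

Lemma is_iso_comp (V1 V2 V3 K1 K2 K3 : finType)
    (G1 : graph V1 K1) (G2 : graph V2 K2) (G3 : graph V3 K3)
    f1 h1 f2 h2 :
  is_iso G1 G2 f1 h1 -> is_iso G2 G3 f2 h2 ->
  is_iso G1 G3 [ffun v => f2 (f1 v)] [ffun x => h2 (h1 x)].
Proof.
have bij_comp (A B C : finType) (f : {ffun A -> B}) (h : {ffun B -> C}) :
    bij f -> bij h -> bij [ffun a => h (f a)].
  case/bijP=> f' [fK f'K] /bijP[h' [hK h'K]]; apply/bijP.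
  exists [ffun c => f' (h' c)].
  by split=> a; rewrite !ffunE ?hK ?fK ?f'K ?h'K.
have im_comp (P : {set {set K1}}) :
    [set [ffun x => h2 (h1 x)] @: (e : {set K1}) | e in P]
    = [set h2 @: (e : {set K2}) | e in [set h1 @: (e : {set K1}) | e in P]].
  rewrite -imset_comp; apply: eq_imset => e /=.
  by rewrite -imset_comp; apply: eq_imset => x; rewrite ffunE.
case/and5P=> bf1 bh1 /eqP i1 /eqP o1 /forallP a1.
case/and5P=> bf2 bh2 /eqP i2 /eqP o2 /forallP a2.
rewrite /is_iso !bij_comp //= !im_comp i1 o1 i2 o2 !eqxx /=.
apply/forallP=> x; rewrite ffunE (eqP (a2 _)) (eqP (a1 _)).
by case: (att G1 x) => //= v; rewrite ffunE.
Qed.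

Lemma is_iso_inv (V V' K K' : finType) (G : graph V K) (G' : graph V' K')
    (f : {ffun V -> V'}) (h : {ffun K -> K'})
    (f' : {ffun V' -> V}) (h' : {ffun K' -> K}) :
  cancel f f' -> cancel f' f -> cancel h h' -> cancel h' h ->
  is_iso G G' f h -> is_iso G' G f' h'.
Proof.
move=> fK f'K hK h'K /and5P[_ _ /eqP ei /eqP eo /forallP a].
have im_inv (P : {set {set K}}) :
    [set h' @: (e : {set K'}) | e in [set h @: (e : {set K}) | e in P]] = P.
  rewrite -imset_comp -[RHS]imset_id; apply: eq_imset => e /=.
  by rewrite -imset_comp -[RHS]imset_id; apply: eq_imset => x /=; rewrite hK.
rewrite /is_iso -ei -eo !im_inv !eqxx /=; apply/and3P; split.
- by apply/bijP; exists f.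
- by apply/bijP; exists h.
apply/forallP=> x; rewrite -{2}[x]h'K (eqP (a _)).
by case: (att G _) => //= v; rewrite fK.
Qed.

Lemma same_up_to_ends_refl (V K : finType) (G : graph V K) :
  same_up_to_ends G G.
Proof. by apply/existsP; exists [ffun x => x]; apply: is_iso_refl. Qed.

Lemma same_up_to_ends_sym (V K K' : finType)
    (G : graph V K) (G' : graph V K') :
  same_up_to_ends G G' -> same_up_to_ends G' G.
Proof.
case/existsP=> h iso; have /and5P[_ /bijP[h' [hK h'K]] _ _ _] := iso.
apply/existsP; exists h'; apply: is_iso_inv (iso) => //.
  by move=> v; rewrite !ffunE.
by move=> v; rewrite !ffunE.
Qed.

Lemma same_up_to_ends_trans (V K1 K2 K3 : finType)
    (G1 : graph V K1) (G2 : graph V K2) (G3 : graph V K3) :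
  same_up_to_ends G1 G2 -> same_up_to_ends G2 G3 -> same_up_to_ends G1 G3.
Proof.
case/existsP=> h1 iso1 /existsP[h2 iso2]; apply/existsP.
exists [ffun x => h2 (h1 x)].
suff <- : [ffun v => [ffun v => v] ([ffun v => v] v)] = [ffun v : V => v].
  exact: is_iso_comp iso1 iso2.
by apply/ffunP=> v; rewrite !ffunE.
Qed.

Lemma graphP (V K : finType) (G : graph V K) : graph_valid (gval G).
Proof. by case: G. Qed.

(* Any finite set of ends can be renumbered as 'I_N, so graphs on all finite
   sets of ends are represented by graphs on the sets 'I_N. *)
Definition numbered_graph (n : nat) := {N : nat & graph 'I_n 'I_N}.

Definition same_graph n : rel (numbered_graph n) :=
  fun G H => same_up_to_ends (tagged G) (tagged H).

Lemma same_graph_refl n : reflexive (@same_graph n).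
Proof. by move=> G; apply: same_up_to_ends_refl. Qed.

Lemma same_graph_sym n : symmetric (@same_graph n).
Proof. by move=> G H; apply/idP/idP; apply: same_up_to_ends_sym. Qed.

Lemma same_graph_trans n : transitive (@same_graph n).
Proof. by move=> H G J; apply: same_up_to_ends_trans. Qed.

Canonical same_graph_equiv n :=
  EquivRel (@same_graph n) (@same_graph_refl n) (@same_graph_sym n)
    (@same_graph_trans n).

(* The graphs with vertices v_1, ..., v_n (numbered from 0) and s external
   edges, any number of internal edges, up to renaming of the ends. *)
Definition vgraph n := {eq_quot (@same_graph n)}.

HB.instance Definition _ n := Choice.on (vgraph n).
HB.instance Definition _ n := Quotient.on (vgraph n).

Definition vclass n N (G : graph 'I_n 'I_N) : vgraph n :=
  \pi_(vgraph n) (Tagged (fun N => graph 'I_n 'I_N) G).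

(* Everything below that is defined from [vrepr] does not depend on the
   choice of the representative. *)
Definition vrepr n (G : vgraph n) : graph 'I_n 'I_(tag (repr G)) :=
  tagged (repr G).

Definition Vset (n k : nat) : pred (vgraph n) :=
  [pred G | has_cyclomatic (vrepr G) k].

Definition Vconn (n k : nat) : pred (vgraph n) :=
  [pred G in @Vset n k | connected (vrepr G)].

Definition viso n : rel (vgraph n) :=
  fun G H => isomorphic (vrepr G) (vrepr H).

Definition is_iso_class n (C : {pred vgraph n}) : Prop :=
  exists G, C =i viso G.

Definition vsym n (G : vgraph n) : nat := symmetry_factor (vrepr G).

Section AddEdge.
Variables (n N : nat) (v w : 'I_n) (G : graph 'I_n 'I_N).

Definition old_end : 'I_N -> 'I_(N + 2) := @lshift N 2.
Definition new_end : 'I_2 -> 'I_(N + 2) := @rshift N 2.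

Definition add_edge_att (x : 'I_(N + 2)) : 'I_n + 'I_s :=
  match split x with
  | inl y => att G y
  | inr b => inl (if b == ord0 then v else w)
  end.

Definition add_edge_data : graph_data 'I_n 'I_(N + 2) :=
  ([set new_end b | b : 'I_2] |: [set old_end @: (e : {set 'I_N}) | e in eint G],
   [set old_end @: (e : {set 'I_N}) | e in eext G],
   [ffun x => add_edge_att x]).

Lemma old_end_inj : injective old_end.
Proof. exact: lshift_inj. Qed.

Lemma new_end_inj : injective new_end.
Proof. exact: rshift_inj. Qed.

Lemma add_edge_att_old y : add_edge_att (old_end y) = att G y.
Proof. by rewrite /add_edge_att (unsplitK (inl y)). Qed.

Lemma add_edge_att_new b :
  add_edge_att (new_end b) = inl (if b == ord0 then v else w).
Proof. by rewrite /add_edge_att (unsplitK (inr b)). Qed.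

Lemma add_edge_valid : graph_valid add_edge_data.
Proof.
have /graph_validP[partE disjE cardE intE [extE labE]] := graphP G.
have ends_disj (x : 'I_N) b : old_end x != new_end b.
  by rewrite -val_eqE /= neq_ltn (leq_trans (ltn_ord x) (leq_addr _ _)).
have new_disj (e : {set 'I_N}) :
    [disjoint [set new_end b | b : 'I_2] & [set old_end x | x in e]].
  apply/pred0P=> x /=; apply/negbTE/negP=> /andP[/imsetP[b _ ->]].
  by case/imsetP=> y _ /eqP; rewrite eq_sym (negbTE (ends_disj _ _)).
apply/graph_validP; split=> /=; rewrite /eint /eext.
- rewrite -setUA -imsetU.
  have -> : [set: 'I_(N + 2)]
            = [set new_end b | b : 'I_2] :|: [set old_end x | x in [set: 'I_N]].
    apply/setP=> x; rewrite !inE; case: (split_ordP x) => y ->.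
      by rewrite [X in _ || X](imset_f old_end) ?orbT ?inE.
    by rewrite [X in X || _](imset_f new_end).
  apply: partitionU1.
  - by rewrite imset_partition //; apply: old_end_inj.
  - by apply/set0Pn; exists (new_end ord0); apply: imset_f.
  - exact: new_disj.
- apply/pred0P=> e; apply/negbTE/negP=> /=.
  case/andP=> /setU1P[->|/imsetP[f fE ->]] /imsetP[g gE eq_g].
    have := new_disj g; rewrite -eq_g -setI_eq0 setIid.
    by move=> /eqP/setP/(_ (new_end ord0)); rewrite inE imset_f.
  move/(imset_inj old_end_inj): eq_g gE => <-.
  by have /pred0P/(_ f)/= := disjE; rewrite [_ \in _](fE : _ = true) /= => ->.
- move=> e; rewrite -setUA -imsetU => /setU1P[->|/imsetP[f fE ->]].
    by rewrite (card_imset _ new_end_inj) card_ord.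
  by rewrite (card_imset _ old_end_inj); apply: cardE.
- move=> e x /setU1P[->|/imsetP[f fE ->]] /imsetP[y y_in ->].
    by rewrite ffunE add_edge_att_new.
  by rewrite ffunE add_edge_att_old; apply: intE y_in.
split.
- move=> e /imsetP[f fE ->]; rewrite -(extE f fE) -(card_imset _ old_end_inj).
  apply: eq_card => x; rewrite !inE; apply/andP/imsetP.
    case=> /imsetP[y yf ->]; rewrite ffunE add_edge_att_old => free_y.
    by exists y => //; rewrite inE yf.
  case=> y; rewrite inE => /andP[yf free_y] ->.
  by rewrite ffunE add_edge_att_old free_y imset_f.
- move=> j; rewrite -(labE j) -(card_imset _ old_end_inj).
  apply: eq_card => x; rewrite !inE ffunE; apply/eqP/imsetP.
    case: (split_ordP x) => y ->; last by rewrite add_edge_att_new.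
    by rewrite add_edge_att_old => attj; exists y; rewrite // inE; apply/eqP.
  by case=> y; rewrite inE => /eqP attj ->; rewrite add_edge_att_old.
Qed.

Definition add_edge : graph 'I_n 'I_(N + 2) := Graph add_edge_valid.
End AddEdge.

Section SplitVertex.
Variables (n N : nat) (i : 'I_n) (B : {set 'I_N}) (G : graph 'I_n 'I_N).

Definition old_vertex : 'I_n -> 'I_n.+1 := widen_ord (leqnSn n).
Definition new_vertex : 'I_n.+1 := ord_max.

Definition split_vertex_att (x : 'I_N) : 'I_n.+1 + 'I_s :=
  if (att G x == inl i) && (x \in B) then inl new_vertex
  else move_vertex old_vertex (att G x).

Definition split_vertex_data : graph_data 'I_n.+1 'I_N :=
  (eint G, eext G, [ffun x => split_vertex_att x]).

Lemma is_inl_split_vertex_att x : is_inl (split_vertex_att x) = is_inl (att G x).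
Proof.
rewrite /split_vertex_att; case: ifP => [/andP[/eqP-> //]|_].
by case: (att G x).
Qed.

Lemma split_vertex_att_label x j :
  (split_vertex_att x == inr j) = (att G x == inr j).
Proof.
rewrite /split_vertex_att; case: ifP => [/andP[/eqP-> //]|_].
by case: (att G x).
Qed.

Lemma split_vertex_valid : graph_valid split_vertex_data.
Proof.
have /graph_validP[partE disjE cardE intE [extE labE]] := graphP G.
apply/graph_validP; split=> //=.
  by move=> e x eE xe; rewrite ffunE is_inl_split_vertex_att; apply: intE xe.
split=> [e eE|j].
  rewrite -(extE e eE); apply: eq_card => x.
  by rewrite !inE ffunE is_inl_split_vertex_att.
by rewrite -(labE j); apply: eq_card => x; rewrite !inE ffunE split_vertex_att_label.
Qed.

Definition split_vertex : graph 'I_n.+1 'I_N := Graph split_vertex_valid.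
End SplitVertex.

(* The ends [lshift s j] and [rshift s j] form the external edge x_(j+1). *)
Definition single_vertex_data : graph_data 'I_1 'I_(s + s) :=
  (set0,
   [set [set lshift s j; rshift s j] | j : 'I_s],
   [ffun x => match split x with inl _ => inl ord0 | inr j => inr j end]).

Lemma single_vertex_valid : graph_valid single_vertex_data.
Proof.
apply/graph_validP; split=> /=.
- rewrite set0U.
  have -> : [set: 'I_(s + s)]
            = cover [set [set lshift s j; rshift s j] | j : 'I_s].
    apply/setP=> x; rewrite inE; apply/esym/bigcupP.
    case: (split_ordP x) => j ->; exists [set lshift s j; rshift s j];
      by [apply/imsetP; exists j | rewrite !inE eqxx ?orbT].
  apply: (proj1 (indexed_partition _ _)) => [i j _ _ neq_ij|j _]; last first.
    by apply/set0Pn; exists (lshift s j); rewrite !inE eqxx.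
  rewrite disjoints_subset; apply/subsetP=> x; rewrite !inE.
  case/orP=> /eqP->; rewrite ?(inj_eq (@lshift_inj _ _))
    ?(inj_eq (@rshift_inj _ _)) ?eq_lrshift ?eq_rlshift ?orbF /=;
    by rewrite eq_sym.
- by rewrite -setI_eq0 set0I.
- by move=> e; rewrite set0U => /imsetP[j _ ->]; rewrite cards2 eq_lrshift.
- by move=> e x; rewrite inE.
split=> [e /imsetP[j _ ->]|j].
  apply: etrans (cards1 (rshift s j)); apply: eq_card => x; rewrite !inE ffunE.
  case: (split_ordP x) => i ->.
    by rewrite andbF eq_lrshift.
  by rewrite eq_rlshift andbT.
apply: etrans (cards1 (rshift s j)); apply: eq_card => x; rewrite !inE ffunE.
case: (split_ordP x) => i ->; first by rewrite eq_lrshift.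
by rewrite (inj_eq (@rshift_inj _ _)).
Qed.

Definition single_vertex : vgraph 1 := vclass (Graph single_vertex_valid).

(* The free Q-vector space on all the graphs with n vertices; QV^(n,k,s) is
   the subspace of the elements with support in [Vset n k]. *)
Definition QV (n : nat) := {malg rat[vgraph n]}.

Definition linear_extension n n' (f : vgraph n -> QV n') (u : QV n) : QV n' :=
  \sum_(G <- msupp u) u@_G *: f G.

Definition tmap n (i : 'I_n) : QV n -> QV n :=
  linear_extension (fun G => << vclass (add_edge i i (vrepr G)) >>).

Definition lmap n (i j : 'I_n) : QV n -> QV n :=
  linear_extension (fun G => << vclass (add_edge i j (vrepr G)) >>).

(* [E.1] stays at v_i and [E.2] moves to the new vertex. *)
Definition smap n (i : 'I_n) : QV n -> QV n.+1 :=
  linear_extension (fun G =>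
    \sum_(E : {set _} * {set _} |
            [disjoint E.1 & E.2] && (E.1 :|: E.2 == ends_at (vrepr G) i))
      << vclass (split_vertex i E.2 (vrepr G)) >>).

Definition q1map n (i : 'I_n) (u : QV n) : QV n.+1 :=
  2^-1 *: lmap (old_vertex i) (new_vertex n) (smap i u).

(* The value for 0 vertices is a dummy. *)
Fixpoint omega (n : nat) : nat -> QV n :=
  match n with
  | 0 => fun=> 0
  | n'.+1 =>
    fix omega_n (k : nat) : QV n'.+1 :=
      let step := (k + n')%:R^-1 *:
        (\sum_(i < n') q1map i (omega n' k)
         + 2^-1 *: (if k is k'.+1 then \sum_(i < n'.+1) tmap i (omega_n k')
                    else 0)) in
      match n', k return QV n'.+1 -> QV n'.+1 with
      | 0, 0 => fun=> << single_vertex >>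
      | _, _ => id
      end step
  end.

Lemma omega_base : omega 1 0 = << single_vertex >>.
Proof. by []. Qed.

Lemma omega_rec n k : (n, k) <> (0, 0)%N ->
  omega n.+1 k = (k + n)%:R^-1 *:
    (\sum_(i < n) q1map i (omega n k)
     + 2^-1 *: (if k is k'.+1 then \sum_(i < n.+1) tmap i (omega n.+1 k')
                else 0)).
Proof. by case: n => [|n]; case: k. Qed.

End Graphs.

Arguments Vset : clear implicits.
Arguments Vconn : clear implicits.
Arguments omega : clear implicits.

(* Main.v *)
Require Import Defs.
From HB Require Import structures.
From mathcomp Require Import all_boot all_order all_algebra.
From mathcomp Require Import finmap.
From mathcomp.multinomials Require Import monalg.

(** The proof counts isomorphisms onto a fixed graph instead of summing over
isomorphism classes. Let H be a graph with n vertices, on arbitrary finite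
sets of vertices and ends, and let f be a bijection from v_1, ..., v_n to the
vertices of H. The weight w(H, f) is the sum, over all G, of the coefficient
of G in omega^(n,k,s) times the number of bijections of ends that form,
together with f, an isomorphism from G onto H.

For a class C and H in C, there are S^C isomorphisms from each G in C onto H
and none from the other graphs, so the identity of the theorem says that the
sum of w(H, f) over all f is 1 ([card_isos], [weight_sum]). For f the identity
and H = G, the weight is a positive multiple of the coefficient of G
([weight_id]), so the support of omega and the positivity of its coefficients
are read off from the sign of the weights ([weight_sign]).

The weights obey a recursion ([weight_rec]). Orient each internal edge of H in
both ways. An isomorphism from t_i(G) onto H amounts to an oriented loop a of
H, the image of the new loop, and an isomorphism from G onto H \ a, which
determines i ([iso_count_add_edge]). An isomorphism from a term of
l_(i,n+1)(s_i(G)) onto H amounts to an oriented edge a of H that is not a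
loop, the image of the new edge, and an isomorphism from G onto the
contraction H / a: the vertex v_i corresponds to the merged vertex, and the
distribution of its ends over v_i and v_(n+1) is the distribution over the two
vertices of a in H ([iso_count_split]). Hence
<<
  2 (k + n - 1) w(H, f) = sum_a w(H / a, f_a) + sum_b w(H \ b, f),
>>
where a runs over the oriented edges, other than loops, that point to f(v_n),
and b over the oriented loops. The factors 1/2 in the definition of omega
account for the two orientations.

Contracting an edge that is not a loop preserves k, deleting a loop lowers k
by one, and in both cases the new graph is connected if and only if H is. By
induction every term of the recursion is therefore positive when H is
connected with cyclomatic number k, and zero otherwise. Summing the recursion
over all f, each oriented internal edge contributes 1 by induction; as H has
k + n - 1 internal edges, the two sides agree exactly when the weights of H
sum to 1. *)

Set Implicit Arguments.
Unset Strict Implicit.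
Unset Printing Implicit Defensive.

Import Order.TTheory GRing.Theory Num.Theory.
Local Open Scope ring_scope.

(** * Graphs as involutions on the ends *)

Section Partner.
Variables (s : nat) (V K : finType) (G : graph s V K).

(** The edges form a partition into pairs, so they are the orbits of an
involution without fixed points. The involution and the attachment of the ends
determine the graph: an edge is internal when both of its ends are assigned to
vertices. Equations between ends replace equations between sets of sets. *)
Definition partner (x : K) : K :=
  odflt x [pick y | (y != x) && ([set x; y] \in eint G :|: eext G)].

Lemma partner_edge e x :
  e \in eint G :|: eext G -> x \in e -> partner x != x /\ e = [set x; partner x].
Proof.
have /graph_validP[partE _ cardE _ _] := graphP G.
move=> eE xe; have /eqP/cards2P[a [b [ab eab]]] := cardE e eE.
have [y yx ey] : exists2 y, y != x & e = [set x; y].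
  move: xe; rewrite eab !inE => /orP[]/eqP->; first by exists b; rewrite 1?eq_sym.
  by exists a => //; apply/setP=> z; rewrite !inE orbC.
rewrite /partner; case: pickP => [z /andP[zx zE]|none] /=; last first.
  by have := none y; rewrite yx -ey eE.
split=> //; have /and3P[_ triv _] := partE.
have xz : x \in [set x; z] by rewrite !inE eqxx.
by rewrite -(def_pblock triv zE xz) (def_pblock triv eE xe).
Qed.

Lemma partner_in x : [set x; partner x] \in eint G :|: eext G.
Proof.
have /graph_validP[partE _ cardE _ _] := graphP G.
have /and3P[/eqP cov triv _] := partE.
have xc : x \in cover (eint G :|: eext G) by rewrite [cover _]cov inE.
have xb : x \in pblock (eint G :|: eext G) x by rewrite mem_pblock.
have bE := pblock_mem xc.
by have [_ <-] := partner_edge bE xb.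
Qed.

Lemma partner_neq x : partner x != x.
Proof. by have [] := partner_edge (partner_in x) (set21 _ _). Qed.

Lemma partnerK : involutive partner.
Proof.
move=> x; have [px E] := partner_edge (partner_in x) (set22 _ _).
have: x \in [set x; partner x] by rewrite !inE eqxx.
by rewrite E !inE eq_sym (negbTE (partner_neq x)) => /eqP.
Qed.

Lemma partner_inj : injective partner.
Proof. exact: can_inj partnerK. Qed.

Definition internal (x : K) := is_inl (att G x) && is_inl (att G (partner x)).

Lemma internal_partner x : internal (partner x) = internal x.
Proof. by rewrite /internal partnerK andbC. Qed.

Lemma internalE x : internal x = ([set x; partner x] \in eint G).
Proof.
have /graph_validP[_ disjE _ intE [extE _]] := graphP G.
have /setUP[xE|xE] := partner_in x.
  by rewrite xE /internal !(intE _ _ xE) // !inE eqxx ?orbT.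
have -> : ([set x; partner x] \in eint G) = false := disjointFl disjE xE.
apply/negbTE/negP=> /andP[ax apx].
have := extE _ xE.
suff -> : [set y in [set x; partner x] | ~~ is_inl ((gval G).2 y)] = set0.
  by rewrite cards0.
apply/setP=> y; rewrite !inE; apply/negbTE; rewrite negb_and negbK.
by case: eqP => [->|_]; rewrite ?[is_inl _]ax ?orbT //=;
   case: eqP => [->|_]; rewrite ?[is_inl _]apx ?orbT //=.
Qed.

Lemma is_inl_partner x : is_inl (att G x) || is_inl (att G (partner x)).
Proof.
have /graph_validP[_ disjE _ intE [extE _]] := graphP G.
case I: (internal x); first by case/andP: I => ->.
have /setUP[xE|/extE] := partner_in x; first by rewrite internalE xE in I.
apply: contra_eqT; rewrite negb_or => /andP[ax apx].
suff -> : [set y in [set x; partner x] | ~~ is_inl ((gval G).2 y)] = [set x; partner x].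
  by rewrite cards2 [x == _]eq_sym partner_neq.
apply/setP=> y; rewrite !inE andb_idr // => /orP[]/eqP-> //.
Qed.

Lemma eintE : eint G = [set [set x; partner x] | x in internal].
Proof.
have /graph_validP[_ _ cardE _ _] := graphP G.
apply/setP=> e; apply/idP/imsetP=> [eI|[x xI ->]]; last by rewrite -internalE.
have eE : e \in eint G :|: eext G by rewrite inE eI.
have /eqP/cards2P[a [b [_ eab]]] := cardE e eE.
have ae : a \in e by rewrite eab !inE eqxx.
have [_ ea] := partner_edge eE ae.
by exists a => //; rewrite [_ \in _]internalE -ea.
Qed.

Lemma eextE : eext G = [set [set x; partner x] | x in predC internal].
Proof.
have /graph_validP[_ disjE cardE _ _] := graphP G.
apply/setP=> e; apply/idP/imsetP=> [eX|[x xI ->]]; last first.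
  by have := partner_in x; rewrite inE -internalE (negbTE xI).
have eE : e \in eint G :|: eext G by rewrite inE eX orbT.
have /eqP/cards2P[a [b [_ eab]]] := cardE e eE.
have ae : a \in e by rewrite eab !inE eqxx.
have [_ ea] := partner_edge eE ae; exists a => //.
rewrite !inE internalE -ea; apply/negP=> eI.
by move: disjE => /pred0P/(_ e) /=; rewrite [_ \in _]eI [_ \in _]eX.
Qed.

Lemma edge_inj x y : [set x; partner x] = [set y; partner y] ->
  y = x \/ y = partner x.
Proof.
move=> /setP/(_ y); rewrite !inE eqxx /=.
by case/orP=> /eqP->; [left|right].
Qed.

(** Each internal edge is counted once for each of its two orientations. *)
Lemma card_internal : #|internal| = (2 * #|eint G|)%N.
Proof.
rewrite -[LHS]sum1_card (partition_big_imset (fun x => [set x; partner x])) /=.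
rewrite -eintE mulnC -sum_nat_const; apply: eq_bigr => e.
rewrite {1}eintE => /imsetP[x xI ->]; rewrite sum1_card.
transitivity #|[set x; partner x]|; last by rewrite cards2 eq_sym partner_neq.
apply: eq_card => y; rewrite !inE; apply/andP/orP=> [[_ /eqP/esym/edge_inj[]->]|].
- by left.
- by right.
case=> /eqP->; first by rewrite eqxx.
by rewrite [_ \in _]internal_partner partnerK; split=> //; rewrite setUC.
Qed.

Lemma label_unique x y j : att G x = inr j -> att G y = inr j -> x = y.
Proof.
have /graph_validP[_ _ _ _ [_ labE]] := graphP G.
move=> xj yj; have /eqP/cards1P[z E] := labE j.
have : x \in [set x | (gval G).2 x == inr j] by rewrite inE; apply/eqP.
have : y \in [set x | (gval G).2 x == inr j] by rewrite inE; apply/eqP.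
by rewrite !E !inE => /eqP-> /eqP->.
Qed.

Lemma label_exists j : exists x, att G x == inr j.
Proof.
have /graph_validP[_ _ _ _ [_ labE]] := graphP G.
have /eqP/cards1P[z E] := labE j; exists z.
by have := set11 z; rewrite -E inE.
Qed.

Lemma adjacentP v w :
  reflect (exists x, att G x = inl v /\ att G (partner x) = inl w)
          (adjacent G v w).
Proof.
apply: (iffP exists_inP) => [[e eI /exists_inP[x xe /exists_inP[y ye]]]|[x [xv xw]]].
  case/and3P=> xy /eqP xv /eqP yw; exists x; split=> //.
  have eE : e \in eint G :|: eext G by rewrite inE eI.
  have [_ ex] := partner_edge eE xe.
  by move: ye; rewrite ex !inE eq_sym (negbTE xy) => /eqP <-.
exists [set x; partner x]; first by rewrite -internalE /internal xv xw.
apply/exists_inP; exists x; first exact: set21.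
apply/exists_inP; exists (partner x); first exact: set22.
by rewrite eq_sym partner_neq xv xw !eqxx.
Qed.

Lemma adjacent_sym : symmetric (adjacent G).
Proof.
by move=> v w; apply/adjacentP/adjacentP=> [] [x [xv xw]];
  exists (partner x); rewrite partnerK.
Qed.

End Partner.

Section Iso.
Variables (s : nat) (V V' K K' : finType) (G : graph s V K) (G' : graph s V' K').

(** The conditions on internal and external edges reduce to commuting with
the involution, because a bijection compatible with the attachments also
preserves which ends belong to internal edges. *)
Lemma is_isoP (f : {ffun V -> V'}) (h : {ffun K -> K'}) :
  reflect [/\ bij f, bij h, (forall x, h (partner G x) = partner G' (h x))
             & (forall x, att G' (h x) = move_vertex f (att G x))]
          (is_iso G G' f h).
Proof.
apply: (iffP and5P) => [[bf bh /eqP hi /eqP he /forallP ha]|[bf bh hp ha]].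
  have hI : injective h by case/bijP: bh => h' [hK _]; apply: can_inj hK.
  split=> // x; last exact/eqP.
  have: h @: [set x; partner G x] \in eint G' :|: eext G'.
    rewrite -hi -he -imsetU; apply: (imset_f (fun e : {set K} => h @: e)).
    exact: partner_in.
  rewrite imsetU1 imset_set1 => /partner_edge/(_ (set21 _ _))[_ /setP/(_ (h (partner G x)))].
  by rewrite !inE eqxx orbT (inj_eq hI) (negbTE (partner_neq _ _)) => /esym/eqP.
have hint x : internal G' (h x) = internal G x.
  by rewrite /internal -hp !ha; do 2![case: (att G _)].
have [h' [hK h'K]] := bijP _ bh.
have im (P : pred K) (P' : pred K') : (forall x, P' (h x) = P x) ->
    [set h @: (e : {set K}) | e in [set [set x; partner G x] | x in P]]
    = [set [set x; partner G' x] | x in P'].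
  move=> PP; rewrite -imset_comp; apply/setP=> e.
  apply/imsetP/imsetP=> -[x xP ->].
    exists (h x); first by rewrite [_ \in _]PP.
    by rewrite /= imsetU1 imset_set1 hp.
  exists (h' x); first by rewrite -[x]h'K [_ \in _]PP in xP.
  by rewrite /= imsetU1 imset_set1 hp h'K.
split=> //; first by rewrite !eintE; apply/eqP/im.
  by rewrite !eextE; apply/eqP/im => x; rewrite /= hint.
by apply/forallP=> x; rewrite ha.
Qed.

End Iso.

(** * Deleting and contracting an internal edge *)

(** Conversely, an involution without fixed points and an attachment map define
a graph as soon as no two free ends are partners and each label occurs once;
deletion of an edge is built in this way. *)
Section InvolutionGraph.
Variables (s : nat) (V K : finType) (p : K -> K) (at_ : K -> V + 'I_s).
Hypotheses (pK : involutive p) (p_neq : forall x, p x != x).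
Hypothesis at_p : forall x, is_inl (at_ x) || is_inl (at_ (p x)).
Hypothesis labE : forall j, #|[set x | at_ x == inr j]| = 1.

Let int x := is_inl (at_ x) && is_inl (at_ (p x)).

Definition involution_data : graph_data s V K :=
  ([set [set x; p x] | x in int], [set [set x; p x] | x in predC int],
   [ffun x => at_ x]).

Lemma involution_valid : graph_valid involution_data.
Proof.
have pairE x y : y \in [set x; p x] -> [set x; p x] = [set y; p y].
  by rewrite !inE => /orP[]/eqP-> //; rewrite pK setUC.
have int_pair x y : y \in [set x; p x] -> int y = int x.
  by rewrite !inE => /orP[]/eqP-> //; rewrite /int pK andbC.
have allE : involution_data.1.1 :|: involution_data.1.2 = [set [set x; p x] | x in K].
  apply/setP=> e; rewrite inE; apply/orP/imsetP=> [[]|[x _ ->]].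
  - by case/imsetP=> x _ ->; exists x.
  - by case/imsetP=> x _ ->; exists x.
  case I: (int x); first by left; apply: (imset_f (fun x => [set x; p x])).
  by right; apply: (imset_f (fun x => [set x; p x])); rewrite inE I.
apply/graph_validP; split.
- rewrite allE; apply/and3P; split.
  + apply/eqP/setP=> x; rewrite inE; apply/bigcupP.
    by exists [set x; p x]; [apply: (imset_f (fun x => [set x; p x])) | apply: set21].
  + apply/trivIsetP=> A B /imsetP[x _ ->] /imsetP[y _ ->] xy.
    apply/pred0P=> z /=; apply: contraNF xy => /andP[/pairE-> /pairE->] //.
  + by apply/imsetP=> -[x _ /setP/(_ x)]; rewrite !inE eqxx.
- apply/pred0P=> e; apply/negP=> /andP[/imsetP[x xI ->] /imsetP[y yI /esym xy]].
  have := negbTE yI; rewrite [LHS](int_pair x) -?xy ?set21 // => xN.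
  by move: xI; rewrite [_ \in _]xN.
- by move=> e; rewrite allE => /imsetP[x _ ->]; rewrite cards2 [x == _]eq_sym p_neq.
- move=> e x /imsetP[y yI ->] /int_pair; rewrite ffunE => xI.
  by have /andP[] : int x by rewrite xI.
split=> [e /imsetP[x xI ->]|j]; last first.
  by rewrite -(labE j); apply: eq_card => x; rewrite !inE ffunE.
have [y [xy ay]] : exists y, [set x; p x] = [set y; p y] /\ is_inl (at_ y).
  by case/orP: (at_p x) => ?; [exists x | exists (p x); rewrite pK setUC].
have Npy : ~~ is_inl (at_ (p y)).
  have : int y = false by rewrite (int_pair x y) ?xy ?set21 //; apply: negbTE xI.
  by rewrite /int ay /= => ->.
rewrite -[RHS](cards1 (p y)) xy; apply: eq_card => z; rewrite !inE ffunE.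
case: (eqVneq z y) => [->|_] /=; first by rewrite ay [y == _]eq_sym (negbTE (p_neq y)).
by case: eqP => [->|].
Qed.

Definition involution_graph : graph s V K := Graph involution_valid.

Lemma att_involution_graph x : att involution_graph x = at_ x.
Proof. by rewrite /att ffunE. Qed.

Lemma partner_involution_graph x : partner involution_graph x = p x.
Proof.
have xE : [set x; p x] \in eint involution_graph :|: eext involution_graph.
  rewrite inE; apply/orP; case I: (int x).
    by left; apply: (imset_f (fun x => [set x; p x])).
  by right; apply: (imset_f (fun x => [set x; p x])); rewrite inE I.
have [_ /setP/(_ (p x))] := partner_edge xE (set21 _ _).
by rewrite !inE eqxx orbT (negbTE (p_neq x)) => /esym/eqP.
Qed.

End InvolutionGraph.

Section MapVertices.
Variables (s : nat) (V V' K : finType) (m : V -> V') (H : graph s V K).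

Definition map_vertices_data : graph_data s V' K :=
  (eint H, eext H, [ffun x => move_vertex m (att H x)]).

Lemma map_vertices_valid : graph_valid map_vertices_data.
Proof.
have inlE (u : V + 'I_s) : is_inl (move_vertex m u) = is_inl u by case: u.
have inrE (u : V + 'I_s) j : (move_vertex m u == inr j) = (u == inr j) by case: u.
have /graph_validP[partE disjE cardE intE [extE labE]] := graphP H.
apply/graph_validP; split=> //=.
  by move=> e x eE xe; rewrite ffunE inlE; apply: intE xe.
split=> [e eE|j].
  by rewrite -(extE e eE); apply: eq_card => x; rewrite !inE ffunE inlE.
by rewrite -(labE j); apply: eq_card => x; rewrite !inE ffunE inrE.
Qed.

Definition map_vertices : graph s V' K := Graph map_vertices_valid.

Lemma att_map_vertices x : att map_vertices x = move_vertex m (att H x).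
Proof. by rewrite /att ffunE. Qed.

Lemma partner_map_vertices x : partner map_vertices x = partner H x.
Proof. by []. Qed.

End MapVertices.

Definition inl_val (A B : Type) (u : A + B) : is_inl u -> A :=
  match u with inl a => fun=> a | inr _ => fun h => match notF h with end end.

Lemma inl_valK (A B : Type) (u : A + B) (h : is_inl u) : inl (inl_val h) = u.
Proof. by case: u h. Qed.

Section EdgeEnd.
Variables (s : nat) (V K : finType) (H : graph s V K).

(** An end of an internal edge encodes an oriented internal edge: the edge
points from [src], the vertex of the chosen end, to [tgt], the vertex of its
partner. *)
Definition edge_end := {a : K | internal H a}.

Definition src (a : edge_end) : V := inl_val (proj1 (andP (valP a))).
Definition tgt (a : edge_end) : V := inl_val (proj2 (andP (valP a))).

Lemma att_src a : att H (val a) = inl (src a).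
Proof. by rewrite /src inl_valK. Qed.

Lemma att_tgt a : att H (partner H (val a)) = inl (tgt a).
Proof. by rewrite /tgt inl_valK. Qed.

Lemma card_edge_end : #|{: edge_end}| = (2 * #|eint H|)%N.
Proof. by rewrite -card_internal card_sig. Qed.

Lemma edge_endP v w :
  reflect (exists a, src a = v /\ tgt a = w) (adjacent H v w).
Proof.
apply: (iffP (adjacentP _ _ _)) => [[x [xv xw]]|[a [<- <-]]]; last first.
  by exists (val a); rewrite att_src att_tgt.
have xI : internal H x by rewrite /internal xv xw.
exists (Sub x xI); split.
  by have := att_src (Sub x xI); rewrite xv => -[].
by have := att_tgt (Sub x xI); rewrite xw => -[].
Qed.

Variable a : edge_end.

Definition other_ends := {x : K | (x != val a) && (x != partner H (val a))}.

Lemma other_partner (x : other_ends) :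
  (partner H (val x) != val a) && (partner H (val x) != partner H (val a)).
Proof.
case: x => x /= /andP[xa xpa]; rewrite (inj_eq (@partner_inj _ _ _ H)) xa andbT.
by apply: contraNneq xpa => <-; rewrite partnerK.
Qed.

Definition del_partner (x : other_ends) : other_ends :=
  exist _ (partner H (val x)) (other_partner x).

Lemma del_partnerK : involutive del_partner.
Proof. by move=> x; apply: val_inj; rewrite /= partnerK. Qed.

Lemma del_partner_neq x : del_partner x != x.
Proof. by rewrite -val_eqE partner_neq. Qed.

Lemma is_inl_del_partner x :
  is_inl (att H (val x)) || is_inl (att H (val (del_partner x))).
Proof. exact: is_inl_partner. Qed.

Lemma del_label j : #|[set x : other_ends | att H (val x) == inr j]| = 1.
Proof.
have [y yj] := label_exists H j.
have y_other : (y != val a) && (y != partner H (val a)).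
  by apply/andP; split; apply: contraTneq yj => ->; rewrite ?att_src ?att_tgt.
apply/eqP/cards1P; exists (Sub y y_other); apply/setP=> x; rewrite !inE -val_eqE /=.
apply/eqP/eqP=> [xj|->]; last exact/eqP.
exact: label_unique xj (eqP yj).
Qed.

Definition del_edge : graph s V other_ends :=
  involution_graph del_partnerK del_partner_neq is_inl_del_partner del_label.

Lemma att_del x : att del_edge x = att H (val x).
Proof. exact: att_involution_graph. Qed.

Lemma partner_del x : val (partner del_edge x) = partner H (val x).
Proof. by rewrite partner_involution_graph. Qed.

Lemma card_eint_del : #|eint H| = #|eint del_edge|.+1.
Proof.
apply: double_inj; rewrite doubleS -!mul2n -!card_internal.
have -> : #|internal H| = #|[set x | internal H x]| by rewrite cardsE.
rewrite -(cardsID [set val a; partner H (val a)]) -[RHS]add2n; congr addn.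
  transitivity #|[set val a; partner H (val a)]|.
    apply: eq_card => x; rewrite inE andb_idl // !inE.
    by case/orP=> /eqP->; rewrite ?internal_partner; apply: valP a.
  by rewrite cards2 [_ == partner _ _]eq_sym partner_neq.
rewrite -(card_image val_inj); apply: eq_card => x; rewrite !inE negb_or.
apply/andP/imageP=> [[xo xI]|[y yI ->]].
  exists (exist _ x xo) => //.
  by rewrite [_ \in _]/(_ && _) !att_del partner_del.
split; first exact: valP y.
by move: yI; rewrite [_ \in _]/(_ && _) !att_del partner_del.
Qed.

(** The deleted loop only contributed an adjacency of a vertex with itself. *)
Lemma adjacent_del v w : src a = tgt a -> v != w ->
  adjacent del_edge v w = adjacent H v w.
Proof.
move=> loop vw; apply/adjacentP/adjacentP=> [[x [xv xw]]|[x [xv xw]]].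
  by exists (val x); rewrite -partner_del -!att_del.
have xo : (x != val a) && (x != partner H (val a)).
  apply/andP; split; apply: contra_neqN vw => /eqP E; move: xv xw; rewrite E.
    by rewrite att_src att_tgt loop => -[<-] [<-].
  by rewrite partnerK att_src att_tgt loop => -[<-] [<-].
by exists (exist _ x xo); rewrite !att_del partner_del.
Qed.

(** Contraction identifies the target of the edge with its source, and keeps
the name of the source. For a loop nothing is to be identified; the second
disjunct makes the source an element of this type in all cases. *)
Definition merged_vertices := {v : V | (v != tgt a) || (src a == tgt a)}.

Definition merge_vertex (v : V) : merged_vertices :=
  insubd (exist _ (src a) (orNb _) : merged_vertices) v.

Definition contract : graph s merged_vertices other_ends :=
  map_vertices merge_vertex del_edge.

Lemma val_merge v : src a != tgt a ->
  val (merge_vertex v) = if v == tgt a then src a else v.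
Proof. by move=> link; rewrite val_insubd /= (negbTE link) orbF; case: eqP. Qed.

Lemma merge_val (v : merged_vertices) : merge_vertex (val v) = v.
Proof. exact: valKd. Qed.

Lemma card_merged : src a != tgt a -> #|V| = #|{: merged_vertices}|.+1.
Proof.
move=> link; rewrite (cardD1 (tgt a)) inE add1n card_sig; congr _.+1.
by apply: eq_card => v; rewrite !inE (negbTE link) orbF andbT.
Qed.

End EdgeEnd.

(** * Connectedness and cyclomatic number *)

Section Connected.
Variables (s : nat).

Lemma connect_adj_sym (V K : finType) (H : graph s V K) : connect_sym (adjacent H).
Proof. exact/sym_connect_sym/adjacent_sym. Qed.

Lemma connected_del (V K : finType) (H : graph s V K) (a : edge_end H) :
  src a = tgt a -> connected (del_edge a) = connected H.
Proof.
move=> loop; apply: eq_forallb => v; apply: eq_forallb => w.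
apply/idP/idP; apply: connect_sub => {}v {}w vw.
  have [->|neq] := eqVneq v w; first exact: connect0.
  by apply: connect1; rewrite -(adjacent_del loop).
have [->|neq] := eqVneq v w; first exact: connect0.
by apply: connect1; rewrite adjacent_del.
Qed.

(** Every vertex of the graph is linked to the vertex kept by the contraction,
so paths can be carried over in both directions. *)
Lemma connected_contract (V K : finType) (H : graph s V K) (a : edge_end H) :
  src a != tgt a -> connected (contract a) = connected H.
Proof.
move=> link; have mE v := val_merge v link.
have tgt_src : connect (adjacent H) (tgt a) (src a).
  by rewrite connect_adj_sym; apply/connect1/edge_endP; exists a.
have up v : connect (adjacent H) v (val (merge_vertex a v)).
  by rewrite mE; case: eqP => [->|_] //; apply: connect0.
have down y z : adjacent (contract a) y z -> connect (adjacent H) (val y) (val z).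
  case/adjacentP=> x []; rewrite !att_map_vertices partner_map_vertices.
  rewrite !att_del partner_del.
  case xv: (att H _) => [v1|//] [<-]; case xw: (att H _) => [v2|//] [<-].
  apply: connect_trans (up v2); rewrite connect_adj_sym.
  apply: connect_trans (up v1); rewrite connect_adj_sym.
  by apply/connect1/adjacentP; exists (val x).
apply/forallP/forallP=> conn v; apply/forallP=> w.
  apply: connect_trans (up v) _; rewrite connect_adj_sym.
  apply: connect_trans (up w) _.
  have /forallP/(_ (merge_vertex a v))/connectP[p pP ->] := conn (merge_vertex a w).
  elim: p (merge_vertex a w) pP => [|z p IH] y /= => [_|/andP[yz /IH]].
    exact: connect0.
  exact/connect_trans/down.
rewrite -[v]merge_val -[w]merge_val.
have /forallP/(_ (val w))/connectP[p pP ->] := conn (val v).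
elim: p (val v) pP => [|z p IH] y /= => [_|/andP[yz /IH]]; first exact: connect0.
apply: connect_trans; have /adjacentP[x [xy xz]] := yz.
case xo: ((x != val a) && (x != partner H (val a))).
  apply/connect1/adjacentP; exists (exist _ x xo).
  by rewrite !att_map_vertices partner_map_vertices !att_del partner_del /= xy xz.
suff -> : merge_vertex a y = merge_vertex a z by apply: connect0.
apply: val_inj; rewrite !mE; move/negbT: xo; rewrite negb_and !negbK.
case/orP=> /eqP E; move: xy xz; rewrite E ?partnerK att_src att_tgt => -[<-] [<-];
  by rewrite eqxx (negbTE link).
Qed.

(** For a nonempty vertex set, connected graphs with cyclomatic number [k]:
there is one component, and k = m - n + 1 is written without subtraction. *)
Definition conn_cyc (V K : finType) (k : nat) (H : graph s V K) : bool :=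
  connected H && ((k + #|V|)%N == #|eint H|.+1).

Lemma conn_cyc_del (V K : finType) (k : nat) (H : graph s V K) (a : edge_end H) :
  src a = tgt a -> conn_cyc k (del_edge a) = conn_cyc k.+1 H.
Proof.
by move=> loop; rewrite /conn_cyc connected_del // (card_eint_del a) addSn eqSS.
Qed.

Lemma conn_cyc_contract (V K : finType) (k : nat) (H : graph s V K) (a : edge_end H) :
  src a != tgt a -> conn_cyc k (contract a) = conn_cyc k H.
Proof.
move=> link; rewrite /conn_cyc connected_contract // (card_eint_del a).
by rewrite (card_merged link) addnS eqSS.
Qed.

(** Otherwise no path could leave [w]. *)
Lemma link_exists (V K : finType) (H : graph s V K) (w : V) :
  connected H -> (1 < #|V|)%N -> exists a : edge_end H, tgt a = w /\ src a != w.
Proof.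
move=> conn V_gt1.
have [u uw] : exists u, u != w.
  move: V_gt1; rewrite (cardD1 w) inE ltnS => /card_gt0P[u].
  by rewrite !inE => /andP[? _]; exists u.
have /forallP/(_ u)/connectP[p pP uE] := (forallP conn w).
suff /existsP[a /andP[/eqP aw nw]] : [exists a : edge_end H, (tgt a == w) && (src a != w)].
  by exists a.
apply: contraNT uw => /existsPn none; rewrite {}uE.
elim: p pP => //= z p IH /andP[]; rewrite adjacent_sym => /edge_endP[a [az aw]].
by have := none a; rewrite aw az eqxx negbK => /eqP->.
Qed.

(** Contracting edges one by one leads to a single vertex, and each step
removes one vertex and one internal edge. *)
Lemma card_connected_le (V K : finType) (H : graph s V K) :
  connected H -> (#|V| <= #|eint H|.+1)%N.
Proof.
have [n] := ubnP #|V|; elim: n => // n IH in V K H * => Vn conn.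
have [|V_gt1] := leqP #|V| 1; first by move/leq_trans; apply.
have [w _] : exists w : V, true by have /card_gt0P[w] := ltnW V_gt1; exists w.
have [a [aw link]] := link_exists w conn V_gt1; rewrite -aw in link.
have := IH _ _ (contract a); rewrite connected_contract // => /(_ _ conn).
rewrite (card_merged link) (card_eint_del a) ltnS; apply.
by rewrite -(card_merged link).
Qed.

Lemma n_comp_connected (V K : finType) (H : graph s V K) :
  (0 < #|V|)%N -> connected H -> n_comp (adjacent H) V = 1%N.
Proof.
move=> /card_gt0P[v _] conn; rewrite -(n_comp_connect (connect_adj_sym H) v).
by apply: eq_card => w; rewrite !inE; congr (_ && _); have /forallP/(_ w)-> := forallP conn v.
Qed.

End Connected.

Lemma VconnE (s n k : nat) (G : vgraph s n) : (0 < n)%N ->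
  (G \in Vconn s n k) = conn_cyc k (vrepr G).
Proof.
move=> n_gt0; rewrite inE /= andbC /conn_cyc; apply: andb_id2l => conn.
by rewrite inE /has_cyclomatic n_comp_connected ?card_ord // addn1.
Qed.

(** * Counting isomorphisms over a fixed map of vertices *)

Lemma bij_injP (A B : finType) (f : {ffun A -> B}) :
  reflect (injective f /\ forall b, exists a, f a = b) (bij f).
Proof.
apply: (iffP andP) => [[/injectiveP f_inj /forallP f_onto]|[f_inj f_onto]].
  by split=> // b; exists (iinv (f_onto b)); rewrite f_iinv.
split; first exact/injectiveP.
by apply/forallP=> b; have [a <-] := f_onto b; apply: codom_f.
Qed.

(** Keeping the vertex map fixed makes this number depend on [G] only up to
renaming of its ends, so that it is well defined on [vgraph]. *)
Definition iso_count (s : nat) (V V' K K' : finType) (G : graph s V K)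
    (H : graph s V' K') (f : {ffun V -> V'}) : nat :=
  #|[set h : {ffun K -> K'} | is_iso G H f h]|.

Section IsoCount.
Variable s : nat.

Lemma iso_count_gt0P (V V' K K' : finType) (G : graph s V K)
    (H : graph s V' K') (f : {ffun V -> V'}) :
  reflect (exists h, is_iso G H f h) (0 < iso_count G H f)%N.
Proof.
apply: (iffP card_gt0P) => [[h]|[h hi]]; first by rewrite inE; exists h.
by exists h; rewrite inE.
Qed.

Lemma iso_count_bij (V V' K K' : finType) (G : graph s V K)
    (H : graph s V' K') (f : {ffun V -> V'}) :
  ~~ bij f -> iso_count G H f = 0%N.
Proof.
move=> nf; apply/eqP; rewrite -leqn0 leqNgt; apply: contra nf.
by case/iso_count_gt0P=> h /is_isoP[].
Qed.

Lemma iso_count_same (V V' K1 K2 K' : finType) (G1 : graph s V K1)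
    (G2 : graph s V K2) (H : graph s V' K') (f : {ffun V -> V'}) :
  same_up_to_ends G1 G2 -> iso_count G1 H f = iso_count G2 H f.
Proof.
have main L1 L2 (J1 : graph s V L1) (J2 : graph s V L2) :
    same_up_to_ends J1 J2 -> (iso_count J2 H f <= iso_count J1 H f)%N.
  case/existsP=> g g_iso; have /is_isoP[_ /bijP[g' [gK g'K]] _ _] := g_iso.
  have comp_inj : injective (fun h : {ffun L2 -> K'} => [ffun x => h (g x)]).
    move=> h1 h2 /ffunP E; apply/ffunP=> x.
    by have := E (g' x); rewrite !ffunE g'K.
  rewrite /iso_count -(card_imset _ comp_inj); apply/subset_leq_card/subsetP=> h'.
  case/imsetP=> h; rewrite !inE => h_iso ->.
  have := is_iso_comp g_iso h_iso; congr (is_iso _ _ _ _).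
  by apply/ffunP=> v; rewrite !ffunE.
by move=> same; apply/eqP; rewrite eqn_leq !main // same_up_to_ends_sym.
Qed.

Lemma iso_count_id_same (V K K' : finType) (G : graph s V K) (H : graph s V K') :
  (0 < iso_count G H [ffun v => v])%N = same_up_to_ends G H.
Proof. by apply/iso_count_gt0P/existsP. Qed.

Lemma iso_count_vclass (n N : nat) (V' K' : finType) (G : graph s 'I_n 'I_N)
    (H : graph s V' K') f :
  iso_count (vrepr (vclass G)) H f = iso_count G H f.
Proof.
apply: iso_count_same.
have : same_graph (repr (vclass G)) (Tagged (fun N => graph s 'I_n 'I_N) G).
  by apply/eqmodP; rewrite reprK.
exact.
Qed.

Lemma vrepr_same (n : nat) (G H : vgraph s n) :
  same_up_to_ends (vrepr G) (vrepr H) = (G == H).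
Proof.
apply/idP/eqP => [same|->]; last exact: same_up_to_ends_refl.
by rewrite -[G]reprK -[H]reprK; apply/eqmodP.
Qed.

End IsoCount.

(** * Isomorphisms from a graph with an added edge *)

Lemma other_neq (s : nat) (V K : finType) (H : graph s V K) (a : edge_end H)
    (x : other_ends a) : val x <> val a /\ val x <> partner H (val a).
Proof. by case: x => x /= /andP[/eqP ? /eqP ?]. Qed.

Section AddEdge.
Variables (s n N : nat) (i j : 'I_n) (G : graph s 'I_n 'I_N).

Let GG := add_edge i j G.

Lemma att_add_edge_old x : att GG (old_end x) = att G x.
Proof. by rewrite /att /= ffunE add_edge_att_old. Qed.

Lemma att_add_edge_new b : att GG (new_end N b) = inl (if b == ord0 then i else j).
Proof. by rewrite /att /= ffunE add_edge_att_new. Qed.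

Lemma partner_add_edge_old x : partner GG (old_end x) = old_end (partner G x).
Proof.
have: [set old_end x; old_end (partner G x)] \in eint GG :|: eext GG.
  have -> : [set old_end x; old_end (partner G x)] = @old_end N @: [set x; partner G x].
    by rewrite imsetU1 imset_set1.
  rewrite /eint /eext /= -setUA -imsetU; apply/setUP; right.
  exact/(imset_f (fun e : {set 'I_N} => [set old_end x | x in e]))/partner_in.
case/partner_edge/(_ (set21 _ _)) => _ /setP/(_ (old_end (partner G x))).
by rewrite !inE eqxx orbT (inj_eq (@old_end_inj _)) (negbTE (partner_neq _ _)) => /esym/eqP.
Qed.

Lemma partner_add_edge_new : partner GG (new_end N ord0) = new_end N ord_max.
Proof.
have: [set new_end N b | b : 'I_2] \in eint GG :|: eext GG.
  by rewrite inE setU11.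
case/partner_edge/(_ (imset_f _ (erefl : ord0 \in 'I_2))) => _ /setP/(_ (new_end N ord_max)).
rewrite imset_f // !inE (inj_eq (@new_end_inj _)) => /esym/eqP //.
Qed.

Variables (V K : finType) (H : graph s V K) (f : {ffun 'I_n -> V}).

Definition extend_ends (a : edge_end H) (h : {ffun 'I_N -> other_ends a}) :
    {ffun 'I_(N + 2) -> K} :=
  [ffun x => match split x with
             | inl y => val (h y)
             | inr b => if b == ord0 then val a else partner H (val a)
             end].

Lemma extend_old a (h : {ffun 'I_N -> other_ends a}) x :
  extend_ends h (old_end x) = val (h x).
Proof. by rewrite ffunE (unsplitK (inl x)). Qed.

Lemma extend_new a (h : {ffun 'I_N -> other_ends a}) b :
  extend_ends h (new_end N b) = if b == ord0 then val a else partner H (val a).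
Proof. by rewrite ffunE (unsplitK (inr b)). Qed.

Lemma ends_ind (P : 'I_(N + 2) -> Prop) :
  (forall x, P (old_end x)) -> P (new_end N ord0) -> P (new_end N ord_max) ->
  forall x, P x.
Proof.
move=> Pold P0 P1 x; case: (split_ordP x) => y ->; first exact: Pold.
by case: y => -[|[|//]] p1; [move: P0 | move: P1]; congr P; apply: val_inj.
Qed.

Lemma iso_extend a (h : {ffun 'I_N -> other_ends a}) :
  src a = f i -> tgt a = f j ->
  is_iso GG H f (extend_ends h) = is_iso G (del_edge a) f h.
Proof.
move=> ai aj.
apply/is_isoP/is_isoP => -[bf /bij_injP[h_inj h_onto] hp ha]; split=> //.
- apply/bij_injP; split=> [x y hxy|y].
    by apply: (@old_end_inj N); apply: h_inj; rewrite !extend_old hxy.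
  have [x] := h_onto (val y); elim/ends_ind: x => [x||].
  + by rewrite extend_old => /val_inj; exists x.
  + by rewrite extend_new /=; case: (other_neq y) => ne _ E; case: ne.
  + by rewrite extend_new /=; case: (other_neq y) => _ ne E; case: ne.
- move=> x; apply: val_inj; rewrite partner_del -!extend_old.
  by rewrite -hp partner_add_edge_old.
- by move=> x; rewrite att_del -extend_old ha att_add_edge_old.
- apply/bij_injP; split=> [x y|y].
    elim/ends_ind: x => [x||]; elim/ends_ind: y => [y||];
      rewrite ?extend_old ?extend_new //=.
    + by move=> /val_inj/h_inj ->.
    + by case: (other_neq (h x)) => ne _ E; case: ne.
    + by case: (other_neq (h x)) => _ ne E; case: ne.
    + by case: (other_neq (h y)) => ne _ E; case: ne.
    + by move/eqP; rewrite eq_sym (negbTE (partner_neq _ _)).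
    + by case: (other_neq (h y)) => _ ne E; case: ne.
    + by move/eqP; rewrite (negbTE (partner_neq _ _)).
  case yo: ((y != val a) && (y != partner H (val a))).
    by have [x xE] := h_onto (exist _ y yo); exists (old_end x); rewrite extend_old xE.
  move/negbT: yo; rewrite negb_and !negbK => /orP[]/eqP->.
    by exists (new_end N ord0); rewrite extend_new.
  by exists (new_end N ord_max); rewrite extend_new.
- elim/ends_ind=> [x||].
  + by rewrite partner_add_edge_old !extend_old hp partner_del.
  + by rewrite partner_add_edge_new !extend_new.
  + by rewrite -partner_add_edge_new partnerK partner_add_edge_new !extend_new /= partnerK.
- elim/ends_ind=> [x||].
  + by rewrite extend_old att_add_edge_old -ha att_del.
  + by rewrite extend_new att_add_edge_new /= att_src ai.
  + by rewrite extend_new att_add_edge_new /= att_tgt aj.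
Qed.

(** An isomorphism is determined by the oriented edge onto which it maps the
new edge and by its restriction to the old ends. *)
Lemma iso_count_add_edge :
  iso_count GG H f =
  (\sum_(a : edge_end H | (src a == f i) && (tgt a == f j))
     iso_count G (del_edge a) f)%N.
Proof.
have ext_inj a : injective (@extend_ends a).
  move=> h1 h2 E; apply/ffunP=> x; apply: val_inj.
  by rewrite -!extend_old E.
transitivity (\sum_(a : edge_end H | (src a == f i) && (tgt a == f j))
   \sum_(h | is_iso GG H f h) (h (new_end N ord0) == val a))%N; last first.
  apply: eq_bigr => a /andP[/eqP ai /eqP aj].
  rewrite -big_mkcondr sum1_card /iso_count -(card_imset _ (@ext_inj a)).
  apply: eq_card => h; rewrite [LHS]unfold_in.
  apply/andP/imsetP=> [[h_iso /eqP h0]|[h']]; last first.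
    by rewrite inE => h'_iso ->; rewrite iso_extend // h'_iso extend_new /=.
  have /is_isoP[bf /bij_injP[h_inj h_onto] hp ha] := h_iso.
  have h1 : h (new_end N ord_max) = partner H (val a).
    by rewrite -partner_add_edge_new hp h0.
  have ho x : (h (old_end x) != val a) && (h (old_end x) != partner H (val a)).
    by rewrite -h1 -h0 !(inj_eq h_inj) !eq_lrshift.
  have hE : h = extend_ends [ffun x => exist _ (h (old_end x)) (ho x)].
    apply/ffunP; elim/ends_ind=> [x||]; first by rewrite extend_old ffunE.
      by rewrite extend_new.
    by rewrite extend_new.
  by exists [ffun x => exist _ (h (old_end x)) (ho x)]; rewrite // inE -iso_extend // -hE.
rewrite exchange_big /= /iso_count -sum1_card.
rewrite (eq_bigl (is_iso GG H f)); last by move=> h; rewrite inE.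
apply: eq_bigr => h /is_isoP[_ _ hp ha].
have h0I : internal H (h (new_end N ord0)).
  by rewrite /internal -hp partner_add_edge_new !ha !att_add_edge_new.
pose a : edge_end H := exist (fun x => internal H x) _ h0I.
have ai : src a = f i.
  by have := att_src a; rewrite /= ha att_add_edge_new => -[].
have aj : tgt a = f j.
  by have := att_tgt a; rewrite /= -hp ha partner_add_edge_new att_add_edge_new => -[].
rewrite (bigD1 a) ?ai ?aj ?eqxx //= big1 ?addn0 // => b /andP[_ ba].
by rewrite (_ : _ == _ = false) //; apply: contraNF ba; rewrite -val_eqE eq_sym.
Qed.

End AddEdge.

(** * Isomorphisms from a graph with a split vertex *)

Section SplitVertex.
Variables (s n N : nat) (i : 'I_n) (G : graph s 'I_n 'I_N).
(* [m] is a map of vertices that identifies the images of v_i and of the new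
   vertex, and [f'] is the vertex map induced by [f]. *)
Variables (V V' K : finType) (H : graph s V K) (m : V -> V').
Variables (f : {ffun 'I_n.+1 -> V}) (f' : {ffun 'I_n -> V'}).
Hypotheses (bij_f : bij f) (bij_f' : bij f').
Hypothesis m_old : forall v, m (f (old_vertex v)) = f' v.
Hypothesis m_new : m (f (new_vertex n)) = f' i.

Lemma att_split B x : att (split_vertex i B G) x =
  if (att G x == inl i) && (x \in B) then inl (new_vertex n)
  else move_vertex (@old_vertex n) (att G x).
Proof. by rewrite /att /= ffunE. Qed.

(** The same map of ends is an isomorphism for the split graph and for the
graph whose vertices are merged again, provided that the ends moved to the new
vertex are those that land at the image of the new vertex. *)
Lemma iso_split B (h : {ffun 'I_N -> K}) :
  is_iso (split_vertex i B G) H f h =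
  is_iso G (map_vertices m H) f' h &&
  [forall x, (att G x == inl i) ==>
             ((x \in B) == (att H (h x) == inl (f (new_vertex n))))].
Proof.
have [f_inj f_onto] := bij_injP _ bij_f.
have [f'_inj f'_onto] := bij_injP _ bij_f'.
have old_new v : (f (old_vertex v) == f (new_vertex n)) = false.
  rewrite (inj_eq f_inj) -val_eqE /=; apply/negbTE; rewrite neq_ltn ltn_ord //.
apply/is_isoP/andP=> [[_ bh hp ha]|[/is_isoP[_ bh hp ha] /forallP hB]].
  split; last first.
    apply/forallP=> x; apply/implyP=> /eqP xi; rewrite ha att_split xi eqxx /=.
    by case: (x \in B); rewrite /= ?eqxx // (inj_eq (@inl_inj _ _)) old_new.
  apply/is_isoP; split=> // x; rewrite att_map_vertices ha att_split.
  case: ifP => [/andP[/eqP-> _]|_] /=; first by rewrite m_new.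
  by case: (att G x) => //= v; rewrite m_old.
split=> // x; have := ha x; have := hB x.
rewrite att_map_vertices att_split.
case: (att G x) => [v|l] /=; last by case: (att H (h x)) => //= ? _ [->].
case hx: (att H (h x)) => [y|//] /= hBx [].
rewrite !(inj_eq (@inl_inj _ _)) in hBx *.
have [z zy] := f_onto y; rewrite -{y}zy in hx hBx *.
case: (unliftP ord_max z) hx hBx => [v'|] -> hx.
  have <- : old_vertex v' = lift ord_max v'.
    by apply: val_inj; rewrite /= /bump leqNgt ltn_ord.
  rewrite m_old old_new => hBx /f'_inj E; rewrite {v'}E in hx *.
  by move: hBx; case: eqP => //= _ /eqP->.
rewrite [m _]m_new => hBx /f'_inj E; rewrite E eqxx /= in hBx *.
by move: hBx; rewrite eqxx => /eqP->.
Qed.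

(** Exactly one distribution of the ends at v_i is compatible with a given
isomorphism onto the merged graph. *)
Lemma iso_count_split :
  (\sum_(E : {set 'I_N} * {set 'I_N} |
         [disjoint E.1 & E.2] && (E.1 :|: E.2 == ends_at G i))
     iso_count (split_vertex i E.2 G) H f)%N
  = iso_count G (map_vertices m H) f'.
Proof.
pose P (E : {set 'I_N} * {set 'I_N}) :=
  [disjoint E.1 & E.2] && (E.1 :|: E.2 == ends_at G i).
transitivity (\sum_(E | P E) \sum_h is_iso (split_vertex i E.2 G) H f h)%N.
  by apply: eq_bigr => E _; rewrite /iso_count -sum1_card big_mkcond;
     apply: eq_bigr => h _; rewrite inE; case: ifP.
rewrite exchange_big /iso_count -sum1_card [RHS]big_mkcond; apply: eq_bigr => h _.
rewrite inE; case: ifP => h_iso; last first.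
  by rewrite big1 // => E _; rewrite iso_split h_iso.
pose B := [set x in ends_at G i | att H (h x) == inl (f (new_vertex n))].
have PB : P (ends_at G i :\: B, B).
  apply/andP; split; rewrite /= -?setI_eq0; apply/eqP/setP=> x;
    by rewrite !inE; do 2![case: (_ == _)].
rewrite (bigD1 (ends_at G i :\: B, B)) //= big1 ?addn0.
  rewrite iso_split h_iso /=; case: forallP => // -[] x.
  by apply/implyP=> xi; rewrite !inE xi.
case=> E1 E2 /andP[/andP[/= disj /eqP EU] neq].
rewrite iso_split h_iso /=; case: forallP => // hE; case/eqP: neq.
have E2B : E2 = B.
  apply/setP=> x; rewrite !inE; have := hE x.
  case xi: (att G x == inl i) => /=; first by move/eqP.
  move=> _; apply/negbTE/negP=> xE; have : x \in ends_at G i by rewrite -EU inE xE orbT.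
  by rewrite inE xi.
by rewrite -E2B -EU setDUl setDv setU0 (setDidPl disj).
Qed.

End SplitVertex.

(** * Isomorphisms from the graph with one vertex *)

Section Base.
Variables (s : nat) (V K : finType) (H : graph s V K) (f : {ffun 'I_1 -> V}).
Hypothesis bij_f : bij f.

Let G0 := Graph (single_vertex_valid s).

(** The labels determine the image of every free end, hence of its partner.
This defines an isomorphism precisely when all the edges of [H] are external,
that is, when the cyclomatic number of [H] is 0. *)
Lemma iso_count_single : iso_count G0 H f = conn_cyc 0 H :> nat.
Proof.
have [f_inj f_onto] := bij_injP _ bij_f.
have one v : v = f ord0 by have [z <-] := f_onto v; rewrite (ord1 z).
have cardV : #|V| = 1%N.
  by rewrite -(card1 (f ord0)); apply: eq_card => v; rewrite !inE (one v) eqxx.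
have conn : connected H.
  by apply/forallP=> v; apply/forallP=> w; rewrite (one v) (one w) connect0.
rewrite /conn_cyc conn cardV eqSS eq_sym cards_eq0 /=.
have attL j : att G0 (lshift s j) = inl ord0.
  by rewrite /att /= ffunE (unsplitK (inl j)).
have attR j : att G0 (rshift s j) = inr j.
  by rewrite /att /= ffunE (unsplitK (inr j)).
have partL j : partner G0 (lshift s j) = rshift s j.
  have : [set lshift s j; rshift s j] \in eint G0 :|: eext G0.
    by rewrite inE [X in _ || X](imset_f (fun j => [set lshift s j; rshift s j])) ?orbT.
  case/partner_edge/(_ (set21 _ _)) => _ /setP/(_ (rshift s j)).
  by rewrite !inE eqxx eq_rlshift => /esym/eqP.
have partR j : partner G0 (rshift s j) = lshift s j by rewrite -partL partnerK.
pose r j := xchoose (label_exists H j).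
have rP j : att H (r j) = inr j by apply/eqP/(xchooseP (label_exists H j)).
pose h0 : {ffun 'I_(s + s) -> K} :=
  [ffun x => match split x with inl j => partner H (r j) | inr j => r j end].
have h0L j : h0 (lshift s j) = partner H (r j) by rewrite ffunE (unsplitK (inl j)).
have h0R j : h0 (rshift s j) = r j by rewrite ffunE (unsplitK (inr j)).
have h0U h : is_iso G0 H f h -> h = h0.
  case/is_isoP=> _ _ hp ha.
  have hR j : h (rshift s j) = r j.
    by apply: (@label_unique _ _ _ H _ _ j) => //; rewrite ha attR.
  apply/ffunP=> x; case: (split_ordP x) => j ->; last by rewrite hR h0R.
  by rewrite h0L -partR hp hR.
case: eqP => eint0; last first.
  apply/eqP; rewrite -leqn0 leqNgt; apply/negP=> /iso_count_gt0P[h].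
  by case/and5P=> _ _ /eqP; rewrite /eint /= imset0 => /esym.
have h0_iso : is_iso G0 H f h0.
  have ext x : internal H x = false by rewrite internalE eint0 inE.
  have attP j : att H (partner H (r j)) = inl (f ord0).
    have := is_inl_partner H (r j); rewrite rP /=.
    by case: (att H _) => // v _; rewrite (one v).
  apply/is_isoP; split=> //.
  - apply/bij_injP; split=> [x y|x].
      have rI : injective r by move=> j k E; have := rP j; rewrite E rP => -[].
      case: (split_ordP x) => j ->; case: (split_ordP y) => k ->; rewrite ?h0L ?h0R.
      + by move=> /partner_inj/rI->.
      + by move=> E; have := rP k; rewrite -E attP.
      + by move=> E; have := rP j; rewrite E attP.
      + by move=> /rI->.
    case xE: (att H x) => [v|j]; last first.
      by exists (rshift s j); rewrite h0R; apply: (label_unique (rP j) xE).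
    have := ext x; rewrite /internal xE /=.
    case pE: (att H (partner H x)) => [//|j] _; exists (lshift s j); rewrite h0L.
    by rewrite (label_unique (rP j) pE) partnerK.
  - move=> x; case: (split_ordP x) => j ->; first by rewrite partL h0L h0R partnerK.
    by rewrite partR h0L h0R.
  - move=> x; case: (split_ordP x) => j ->; first by rewrite h0L attP attL.
    by rewrite h0R attR rP.
rewrite /iso_count -[RHS](cards1 h0); apply: eq_card => h; rewrite !inE.
by apply/idP/eqP=> [/h0U|->].
Qed.

End Base.

(** * Pairing linear combinations of graphs with isomorphism counts *)

Section Pairing.
Variable s : nat.

Definition pairing (n : nat) (phi : vgraph s n -> rat) (u : QV s n) : rat :=
  mmap idfun phi u.

Lemma pairing_is_linear (n : nat) (phi : vgraph s n -> rat) :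
  linear_for *%R (pairing phi).
Proof.
move=> c u v; rewrite /pairing raddfD /=; congr (_ + _).
rewrite (mmapEw (msuppZ_le _ _)) mmapE mulr_sumr.
by apply: eq_bigr => G _; rewrite mcoeffZ /= mulrA.
Qed.

HB.instance Definition _ (n : nat) (phi : vgraph s n -> rat) :=
  GRing.isLinear.Build rat (QV s n) rat *%R (pairing phi) (pairing_is_linear phi).

Lemma pairingE (n : nat) (phi : vgraph s n -> rat) (u : QV s n) :
  pairing phi u = \sum_(G <- msupp u) u@_G * phi G.
Proof. by []. Qed.

Lemma pairingU (n : nat) (phi : vgraph s n -> rat) (G : vgraph s n) :
  pairing phi << G >> = phi G.
Proof. by rewrite /pairing mmapU mul1r. Qed.

Lemma pairing_linear_extension (n n' : nat) (g : vgraph s n -> QV s n')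
    (phi : vgraph s n' -> rat) (u : QV s n) :
  pairing phi (linear_extension g u) =
  pairing (fun G => pairing phi (g G)) u.
Proof.
rewrite /linear_extension raddf_sum /= [RHS]pairingE.
by apply: eq_bigr => G _; rewrite linearZ.
Qed.

Lemma pairing_sum (n : nat) (I : Type) (r : seq I) (P : pred I)
    (phi : I -> vgraph s n -> rat) (u : QV s n) :
  pairing (fun G => \sum_(i <- r | P i) phi i G) u =
  \sum_(i <- r | P i) pairing (phi i) u.
Proof.
rewrite pairingE; under eq_bigr do rewrite mulr_sumr.
by rewrite exchange_big; apply: eq_bigr => i _; rewrite pairingE.
Qed.

Lemma eq_pairing (n : nat) (phi psi : vgraph s n -> rat) (u : QV s n) :
  phi =1 psi -> pairing phi u = pairing psi u.
Proof. by move=> E; rewrite !pairingE; apply: eq_bigr => G _; rewrite E. Qed.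

Definition iso_pairing (n : nat) (V K : finType) (H : graph s V K)
    (f : {ffun 'I_n -> V}) : QV s n -> rat :=
  pairing (fun G => (iso_count (vrepr G) H f)%:R).

HB.instance Definition _ n V K (H : graph s V K) (f : {ffun 'I_n -> V}) :=
  GRing.Linear.copy (iso_pairing H f) (pairing (fun G => (iso_count (vrepr G) H f)%:R)).

Lemma iso_pairing_vclass (n N : nat) (V K : finType) (H : graph s V K)
    (f : {ffun 'I_n -> V}) (G : graph s 'I_n 'I_N) :
  iso_pairing H f << vclass G >> = (iso_count G H f)%:R.
Proof. by rewrite /iso_pairing pairingU iso_count_vclass. Qed.

Lemma iso_pairing_lmap (n : nat) (V K : finType) (H : graph s V K)
    (f : {ffun 'I_n -> V}) (i j : 'I_n) (u : QV s n) :
  iso_pairing H f (lmap i j u) =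
  \sum_(a : edge_end H | (src a == f i) && (tgt a == f j))
    iso_pairing (del_edge a) f u.
Proof.
rewrite /iso_pairing pairing_linear_extension -pairing_sum; apply: eq_pairing => G.
by rewrite [LHS]iso_pairing_vclass iso_count_add_edge natr_sum.
Qed.

Lemma iso_pairing_smap (n : nat) (V V' K : finType) (H : graph s V K) (m : V -> V')
    (f : {ffun 'I_n.+1 -> V}) (f' : {ffun 'I_n -> V'}) (i : 'I_n) (u : QV s n) :
  bij f -> bij f' -> (forall v, m (f (old_vertex v)) = f' v) ->
  m (f (new_vertex n)) = f' i ->
  iso_pairing H f (smap i u) = iso_pairing (map_vertices m H) f' u.
Proof.
move=> bf bf' m_old m_new.
rewrite /iso_pairing pairing_linear_extension; apply: eq_pairing => G.
rewrite [LHS]raddf_sum -(iso_count_split _ _ bf bf' m_old m_new) natr_sum.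
by apply: eq_bigr => E _; apply: iso_pairing_vclass.
Qed.

(** * The recursion for the weights *)

Definition contract_map (n : nat) (V K : finType) (H : graph s V K)
    (f : {ffun 'I_n.+1 -> V}) (a : edge_end H) :
    {ffun 'I_n -> merged_vertices a} :=
  [ffun v => merge_vertex a (f (old_vertex v))].

Lemma old_vertexE (n : nat) (v : 'I_n) : old_vertex v = lift ord_max v.
Proof. by apply: val_inj; rewrite /= /bump leqNgt ltn_ord. Qed.

Definition expand_map (n : nat) (V K : finType) (H : graph s V K) (a : edge_end H)
    (g : {ffun 'I_n -> merged_vertices a}) : {ffun 'I_n.+1 -> V} :=
  [ffun v => if unlift ord_max v is Some v' then val (g v') else tgt a].

Section ContractMap.
Variables (n : nat) (V K : finType) (H : graph s V K) (a : edge_end H).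
Hypothesis link : src a != tgt a.

Lemma merged_neq (v : merged_vertices a) : val v <> tgt a.
Proof. by case: v => v /=; rewrite (negbTE link) orbF => /eqP. Qed.

Lemma expand_old (g : {ffun 'I_n -> merged_vertices a}) v :
  expand_map g (old_vertex v) = val (g v).
Proof. by rewrite ffunE old_vertexE liftK. Qed.

Lemma expand_new (g : {ffun 'I_n -> merged_vertices a}) :
  expand_map g (new_vertex n) = tgt a.
Proof. by rewrite ffunE unlift_none. Qed.

Lemma expand_mapK (g : {ffun 'I_n -> merged_vertices a}) :
  contract_map (expand_map g) a = g.
Proof. by apply/ffunP=> v; rewrite ffunE expand_old merge_val. Qed.

Lemma contract_mapK (f : {ffun 'I_n.+1 -> V}) :
  bij f -> f (new_vertex n) = tgt a -> expand_map (contract_map f a) = f.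
Proof.
move=> /bij_injP[f_inj _] f_new; apply/ffunP=> v.
have [v' ->|->] := unliftP ord_max v; last by rewrite expand_new.
rewrite -old_vertexE expand_old ffunE val_merge // -f_new (inj_eq f_inj).
by rewrite old_vertexE eq_sym (negbTE (neq_lift _ _)).
Qed.

Lemma bij_expand (g : {ffun 'I_n -> merged_vertices a}) :
  bij (expand_map g) = bij g.
Proof.
apply/bij_injP/bij_injP=> -[g_inj g_onto]; split.
- move=> x y gxy; apply: (@lift_inj _ ord_max); apply: g_inj.
  by rewrite -!old_vertexE !expand_old gxy.
- move=> v; have [w] := g_onto (val v).
  have [w' ->|->] := unliftP ord_max w.
    by rewrite -old_vertexE expand_old => /val_inj; exists w'.
  by rewrite expand_new => /esym/merged_neq.
- move=> x y; have [x' ->|->] := unliftP ord_max x;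
    have [y' ->|->] := unliftP ord_max y; rewrite -?old_vertexE ?expand_old ?expand_new //.
  + by move=> /val_inj/g_inj->.
  + by move/merged_neq.
  + by move/esym/merged_neq.
- move=> v; have [->|vt] := eqVneq v (tgt a).
    by exists (new_vertex n); rewrite expand_new.
  have vP : (v != tgt a) || (src a == tgt a) by rewrite vt.
  have [w wE] := g_onto (exist _ v vP); exists (old_vertex w).
  by rewrite expand_old wE.
Qed.

Lemma bij_contract (f : {ffun 'I_n.+1 -> V}) :
  bij f -> f (new_vertex n) = tgt a -> bij (contract_map f a).
Proof. by move=> bf fn; rewrite -bij_expand contract_mapK. Qed.

(** Vertex maps onto H / a are the same as vertex maps onto H that send the new
vertex to the target of a. *)
Lemma sum_contract_map (F : {ffun 'I_n -> merged_vertices a} -> rat) :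
  \sum_(f | bij f && (f (new_vertex n) == tgt a)) F (contract_map f a) =
  \sum_(g | bij g) F g.
Proof.
rewrite (reindex_onto (@expand_map n V K H a) (fun f => contract_map f a)) /=.
  apply: eq_big => [g|g _]; last by rewrite expand_mapK.
  by rewrite bij_expand expand_new expand_mapK !eqxx !andbT.
by move=> f /andP[bf /eqP fn]; apply: contract_mapK.
Qed.

End ContractMap.

(** Summing over [i] removes the condition on the vertex of the loop, since it
is the image of exactly one v_i. *)
Lemma sum_iso_pairing_tmap (n : nat) (V K : finType) (H : graph s V K)
    (f : {ffun 'I_n -> V}) (u : QV s n) : bij f ->
  \sum_(i < n) iso_pairing H f (tmap i u) =
  \sum_(a : edge_end H | src a == tgt a) iso_pairing (del_edge a) f u.
Proof.
move=> /bij_injP[f_inj f_onto].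
under eq_bigr => i do rewrite [tmap i u]/(lmap i i u) iso_pairing_lmap.
rewrite (exchange_big_dep (fun a : edge_end H => src a == tgt a)) /=; last first.
  by move=> i a _ /andP[/eqP-> /eqP->].
apply: eq_bigr => a /eqP loop; have [i ia] := f_onto (tgt a).
by rewrite (big_pred1 i) // => j; rewrite loop andbb -ia (inj_eq f_inj) eq_sym.
Qed.

(** The target of the contracted edge must be the image of the new vertex, but
its source is free: it is the image of exactly one v_i. *)
Lemma sum_iso_pairing_q1map (n : nat) (V K : finType) (H : graph s V K)
    (f : {ffun 'I_n.+1 -> V}) (u : QV s n) : bij f ->
  \sum_(i < n) iso_pairing H f (q1map i u) =
  2^-1 * \sum_(a : edge_end H | (src a != tgt a) && (tgt a == f (new_vertex n)))
           iso_pairing (contract a) (contract_map f a) u.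
Proof.
move=> bf; have [f_inj f_onto] := bij_injP _ bf; rewrite mulr_sumr.
under eq_bigr => i do rewrite /q1map linearZ /= iso_pairing_lmap mulr_sumr.
rewrite (exchange_big_dep
  (fun a : edge_end H => (src a != tgt a) && (tgt a == f (new_vertex n)))) /=; last first.
  move=> i a _ /andP[/eqP-> /eqP->]; rewrite eqxx andbT (inj_eq f_inj).
  by rewrite old_vertexE eq_sym neq_lift.
apply: eq_bigr => a /andP[link /eqP fn].
have [i ia] : exists i : 'I_n, f (old_vertex i) = src a.
  have [w] := f_onto (src a); have [i ->|->] := unliftP ord_max w.
    by rewrite -old_vertexE; exists i.
  by move=> E; move: link; rewrite -E -fn eqxx.
rewrite (big_pred1 i) => [|j] /=.
  congr (_ * _); apply: iso_pairing_smap => //.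
  - by apply: bij_contract.
  - by move=> v; rewrite ffunE.
  rewrite ffunE ia -fn; apply: val_inj; rewrite !val_merge // eqxx.
  by rewrite (negbTE link).
by rewrite fn eqxx andbT -ia (inj_eq f_inj) !old_vertexE (inj_eq (@lift_inj _ _)) eq_sym.
Qed.

Definition weight (n k : nat) (V K : finType) (H : graph s V K)
    (f : {ffun 'I_n -> V}) : rat := iso_pairing H f (omega s n k).

Lemma weight_base (V K : finType) (H : graph s V K) (f : {ffun 'I_1 -> V}) :
  bij f -> weight 0 H f = (conn_cyc 0 H)%:R.
Proof. by move=> bf; rewrite /weight iso_pairing_vclass iso_count_single. Qed.

Lemma weight_rec (n k : nat) (V K : finType) (H : graph s V K)
    (f : {ffun 'I_n.+1 -> V}) : (n, k) <> (0, 0)%N -> bij f ->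
  weight k H f = (2 * (k + n))%:R^-1 *
    (\sum_(a : edge_end H | (src a != tgt a) && (tgt a == f (new_vertex n)))
        weight k (contract a) (contract_map f a)
     + if k is k'.+1 then
         \sum_(a : edge_end H | src a == tgt a) weight k' (del_edge a) f
       else 0).
Proof.
move=> nk bf; rewrite /weight omega_rec // linearZ /= linearD linear_sum linearZ /=.
rewrite (sum_iso_pairing_q1map _ _ bf) -mulrDr mulrA natrM invfM [2^-1 * _]mulrC.
congr (_ * (_ + _)).
case: k nk => [|k] _; first by rewrite linear0.
by rewrite linear_sum -sum_iso_pairing_tmap.
Qed.

End Pairing.

(** * The signs of the weights *)

Section Sign.

(** The two cases are carried together so that sums need no case analysis. *)
Definition pos_if (b : bool) (x : rat) : bool := if b then 0 < x else x == 0.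

Lemma pos_if_ge0 b x : pos_if b x -> 0 <= x.
Proof. by case: b => [/ltW|/eqP->]. Qed.

Lemma pos_if_add b c x y : pos_if b x -> pos_if c y -> pos_if (b || c) (x + y).
Proof.
move=> bx cy; have := pos_if_ge0 bx; have := pos_if_ge0 cy.
case: b bx => /= [x0 y0 _|/eqP->]; first exact: ltr_wpDr.
by rewrite add0r.
Qed.

Lemma pos_if_sum (I : finType) (P : pred I) (F : I -> rat) b :
  (forall i, P i -> pos_if b (F i)) ->
  pos_if (b && [exists i, P i]) (\sum_(i | P i) F i).
Proof.
move=> Fb; have F0 i (Pi : P i) := pos_if_ge0 (Fb i Pi).
case: b Fb => Fb; last by rewrite /= big1 // => i /Fb/eqP.
case: existsP => [[i Pi]|none] /=; last first.
  by rewrite big_pred0 // => i; apply/negP=> Pi; apply: none; exists i.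
rewrite (bigD1 i) //=; apply: ltr_wpDr; last exact: Fb.
by apply: sumr_ge0 => j /andP[/F0].
Qed.

Lemma pos_if_mul b c x : 0 < c -> pos_if b x -> pos_if b (c * x).
Proof. by case: b => /= c0 => [x0|/eqP->]; rewrite ?mulr0 ?mulr_gt0. Qed.

End Sign.

Section Main.
Variable s : nat.

Lemma bij_card (A B : finType) (f : {ffun A -> B}) : bij f -> #|A| = #|B|.
Proof. by case/bijP=> g [fK gK]; apply: bij_eq_card (Bijective fK gK). Qed.

Lemma all_loops (V K : finType) (H : graph s V K) (a : edge_end H) :
  #|V| = 1%N -> src a = tgt a.
Proof. by move=> /eqP/fintype1P[v allv]; rewrite [LHS]allv [RHS]allv. Qed.

(** Deleting a loop would leave a connected graph with too few edges. *)
Lemma tree_no_loop (V K : finType) (H : graph s V K) (a : edge_end H) :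
  conn_cyc 0 H -> src a != tgt a.
Proof.
case/andP=> conn /eqP cyc; apply/eqP=> loop.
have := card_connected_le (H := del_edge a); rewrite connected_del // => /(_ conn).
by rewrite -card_eint_del -ltnS -cyc add0n ltnn.
Qed.

(** The sum is nonempty because some edge joins the image of the new vertex to
another vertex. *)
Lemma link_sum_sign (n k : nat) (V K : finType) (H : graph s V K)
    (f : {ffun 'I_n.+1 -> V}) :
  (forall (V' K' : finType) (H' : graph s V' K') (f' : {ffun 'I_n -> V'}),
     bij f' -> pos_if (conn_cyc k H' && (0 < n)%N) (weight k H' f')) ->
  bij f ->
  pos_if (conn_cyc k H && (0 < n)%N)
    (\sum_(a : edge_end H | (src a != tgt a) && (tgt a == f (new_vertex n)))
        weight k (contract a) (contract_map f a)).
Proof.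
move=> IHn bf.
have -> : conn_cyc k H && (0 < n)%N = conn_cyc k H && (0 < n)%N &&
    [exists a : edge_end H, (src a != tgt a) && (tgt a == f (new_vertex n))].
  apply/esym/andb_idr => /andP[/andP[conn _] n_gt0].
  have [|a [aw link]] := link_exists (f (new_vertex n)) conn.
    by rewrite -(bij_card bf) card_ord.
  by apply/existsP; exists a; rewrite aw link eqxx.
apply: pos_if_sum => a /andP[link /eqP fn].
by rewrite -(conn_cyc_contract _ link); apply/IHn/bij_contract.
Qed.

Lemma loop_sum_sign (n k : nat) (V K : finType) (H : graph s V K)
    (f : {ffun 'I_n.+1 -> V}) :
  (forall (K' : finType) (H' : graph s V K'), pos_if (conn_cyc k H') (weight k H' f)) ->
  pos_if (conn_cyc k.+1 H && [exists a : edge_end H, src a == tgt a])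
    (\sum_(a : edge_end H | src a == tgt a) weight k (del_edge a) f).
Proof.
move=> IHk; apply: pos_if_sum => a /eqP loop.
by rewrite -(conn_cyc_del _ loop).
Qed.

(** For [n = 0] the weights vanish because [omega] takes the value 0 there;
starting the induction from this case spares a separate treatment of [n = 1],
where every internal edge is a loop. *)
Lemma weight_sign (n k : nat) (V K : finType) (H : graph s V K)
    (f : {ffun 'I_n -> V}) : bij f ->
  pos_if (conn_cyc k H && (0 < n)%N) (weight k H f).
Proof.
elim: n k V K H f => [|n IHn] k V K H f bf.
  by rewrite andbF /pos_if /weight linear0.
rewrite andbT; elim: k K H => [|k IHk] K H.
  have [n0|n_gt0] := posnP n.
    by move: f bf; rewrite n0 => f bf; rewrite weight_base //; case: conn_cyc.
  rewrite weight_rec //; last by case=> n0; rewrite n0 in n_gt0.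
  apply: pos_if_mul; first by rewrite invr_gt0 ltr0n muln_gt0.
  by rewrite addr0; have := link_sum_sign H (IHn 0%N) bf; rewrite n_gt0 andbT.
rewrite weight_rec //; apply: pos_if_mul; first by rewrite invr_gt0 ltr0n muln_gt0.
have := pos_if_add (link_sum_sign H (IHn k.+1) bf) (loop_sum_sign H IHk).
congr (pos_if _ _); rewrite -andb_orr; apply: andb_idr => /andP[_ /eqP cyc].
have [n0|//] := posnP n; apply/existsP.
have cV : #|V| = 1%N by rewrite -(bij_card bf) card_ord n0.
have /card_gt0P[a _] : (0 < #|{: edge_end H}|)%N.
  by rewrite card_edge_end muln_gt0 /= -ltnS -cyc cV addn1.
by exists a; rewrite (all_loops a).
Qed.

(** * The total weight *)

(** The maps [f] that send the new vertex to the target of [a] contribute the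
total weight of the contraction, which is 1. *)
Lemma link_sum_total (n k : nat) (V K : finType) (H : graph s V K) :
  (forall (V' K' : finType) (H' : graph s V' K'),
     (0 < n)%N -> #|V'| = n -> conn_cyc k H' ->
     \sum_(f : {ffun 'I_n -> V'} | bij f) weight k H' f = 1) ->
  #|V| = n.+1 -> conn_cyc k H ->
  \sum_(f : {ffun 'I_n.+1 -> V} | bij f)
    \sum_(a : edge_end H | (src a != tgt a) && (tgt a == f (new_vertex n)))
      weight k (contract a) (contract_map f a)
  = \sum_(a : edge_end H | src a != tgt a) 1.
Proof.
move=> IHn cV cyc.
rewrite (exchange_big_dep (fun a : edge_end H => src a != tgt a)) /=; last first.
  by move=> f a _ /andP[].
apply: eq_bigr => a link.
have n_gt0 : (0 < n)%N.
  by rewrite lt0n; apply: contraNneq link => n0; rewrite (all_loops a) // cV n0.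
rewrite -(IHn _ _ (contract a)) ?conn_cyc_contract //; last first.
  by apply/succn_inj; rewrite -card_merged.
rewrite -(sum_contract_map link); apply: eq_bigl => f.
by rewrite link eq_sym.
Qed.

Lemma weight_sum (n k : nat) (V K : finType) (H : graph s V K) :
  (0 < n)%N -> #|V| = n -> conn_cyc k H ->
  \sum_(f : {ffun 'I_n -> V} | bij f) weight k H f = 1.
Proof.
elim: n k V K H => [//|n IHn] k V K H _ cV.
(* The right-hand side is twice the number of internal edges. *)
have half_edges k' K' (H' : graph s V K') : conn_cyc k' H' ->
    \sum_(a : edge_end H' | src a != tgt a) 1 +
    \sum_(a : edge_end H' | src a == tgt a) 1 = (2 * (k' + n))%:R :> rat.
  move=> /andP[_ /eqP cyc]; rewrite addrC.
  have <- := bigID (fun a : edge_end H' => src a == tgt a) predT (fun=> 1 : rat).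
  by rewrite sumr_const card_edge_end; move: cyc; rewrite cV addnS => -[->].
elim: k K H => [|k IHk] K H cyc; last first.
  under eq_bigr => f bf do rewrite weight_rec //.
  rewrite -mulr_sumr big_split /= (link_sum_total (IHn k.+1)) //.
  rewrite exchange_big /= [X in _ + X](eq_bigr (fun=> 1)) => [|a /eqP loop].
    by rewrite (half_edges k.+1) // mulVf // pnatr_eq0.
  by apply: IHk; rewrite conn_cyc_del.
have [n0|n_gt0] := posnP n.
  move: cV; rewrite n0 => cV; have /eqP/fintype1P[v allv] := cV.
  rewrite (big_pred1 [ffun=> v]) => [|f] /=.
    rewrite weight_base ?cyc //.
    apply/bij_injP; split=> [x y _|w]; first by rewrite !ord1.
    by exists ord0; rewrite [RHS]allv [LHS]allv.
  apply/bij_injP/eqP=> [_|_]; first by apply/ffunP=> x; rewrite [LHS]allv [RHS]allv.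
  by split=> [x y _|w]; [rewrite !ord1 | exists ord0; rewrite [RHS]allv [LHS]allv].
have nk : (n, 0) <> (0, 0)%N by case=> n0; rewrite n0 in n_gt0.
under eq_bigr => f bf do rewrite weight_rec // addr0.
rewrite -mulr_sumr (link_sum_total (IHn 0%N)) //.
have := half_edges _ _ _ cyc; rewrite [X in _ + X]big_pred0 => [|a]; last first.
  exact/negbTE/tree_no_loop.
by rewrite addr0 => ->; rewrite mulVf // pnatr_eq0 muln_eq0 -lt0n n_gt0.
Qed.

(** * Isomorphism classes *)

Lemma isomorphic_sym (V V' K K' : finType) (G : graph s V K) (G' : graph s V' K') :
  isomorphic G G' -> isomorphic G' G.
Proof.
case/existsP=> f /existsP[h iso]; have /is_isoP[bf bh _ _] := iso.
have /bijP[f' [fK f'K]] := bf; have /bijP[h' [hK h'K]] := bh.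
by apply/existsP; exists f'; apply/existsP; exists h'; apply: is_iso_inv iso.
Qed.

Lemma isomorphic_trans (V1 V2 V3 K1 K2 K3 : finType) (G1 : graph s V1 K1)
    (G2 : graph s V2 K2) (G3 : graph s V3 K3) :
  isomorphic G1 G2 -> isomorphic G2 G3 -> isomorphic G1 G3.
Proof.
case/existsP=> f1 /existsP[h1 iso1] /existsP[f2 /existsP[h2 iso2]].
apply/existsP; exists [ffun v => f2 (f1 v)].
by apply/existsP; exists [ffun x => h2 (h1 x)]; apply: is_iso_comp iso2.
Qed.

Lemma sum_iso_count (V V' K K' : finType) (G : graph s V K) (H : graph s V' K') :
  (\sum_(f | bij f) iso_count G H f)%N =
  #|[set psi : {ffun V -> V'} * {ffun K -> K'} | is_iso G H psi.1 psi.2]|.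
Proof.
transitivity (\sum_(f : {ffun V -> V'}) iso_count G H f)%N.
  rewrite big_mkcond; apply: eq_bigr => f _.
  by case: ifPn => // nf; rewrite iso_count_bij.
rewrite -[RHS]sum1_card (eq_bigl (fun psi => is_iso G H psi.1 psi.2)); last first.
  by move=> psi; rewrite inE.
rewrite -(pair_big_dep predT (fun f h => is_iso G H f h) (fun _ _ => 1%N)).
by apply: eq_bigr => f _; rewrite sum1_card /iso_count cardsE.
Qed.

(** The isomorphisms onto H, when there are any, form a torsor under the
automorphisms of H. *)
Lemma card_isos (V V' K K' : finType) (G : graph s V K) (H : graph s V' K') :
  (\sum_(f | bij f) iso_count G H f)%N =
  if isomorphic G H then symmetry_factor H else 0%N.
Proof.
have comp_le V1 K1 V2 K2 (G1 : graph s V1 K1) (G2 : graph s V2 K2) :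
    isomorphic G1 G2 ->
    (#|[set psi | is_iso G2 H psi.1 psi.2]| <= #|[set psi | is_iso G1 H psi.1 psi.2]|)%N.
  case/existsP=> f /existsP[h iso]; have /is_isoP[bf bh _ _] := iso.
  have /bijP[f' [_ f'K]] := bf; have /bijP[h' [_ h'K]] := bh.
  have comp_inj : injective (fun psi : {ffun V2 -> V'} * {ffun K2 -> K'} =>
      ([ffun v => psi.1 (f v)], [ffun x => psi.2 (h x)])).
    move=> [f1 h1] [f2 h2] [] /ffunP Ef /ffunP Eh; congr (_, _); apply/ffunP=> x.
      by have := Ef (f' x); rewrite !ffunE f'K.
    by have := Eh (h' x); rewrite !ffunE h'K.
  rewrite -(card_imset _ comp_inj); apply/subset_leq_card/subsetP=> psi.
  by case/imsetP=> phi; rewrite !inE => phi_iso ->; apply: is_iso_comp phi_iso.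
rewrite sum_iso_count; case: ifP => GH.
  apply/eqP; rewrite eqn_leq comp_le //; last exact: isomorphic_sym.
  exact: comp_le.
apply/eqP; rewrite cards_eq0 -subset0; apply/subsetP=> -[f h]; rewrite inE /= => iso.
by case/negP: (negbT GH); apply/existsP; exists f; apply/existsP; exists h.
Qed.

Lemma bij_id (A : finType) : bij [ffun a : A => a].
Proof. by apply/bijP; exists [ffun a => a]; split=> a; rewrite !ffunE. Qed.

(** Only [G] itself is related to [G] by an isomorphism that fixes every
vertex, since graphs are taken up to renaming of ends. *)
Lemma weight_id (n k : nat) (G : vgraph s n) :
  weight k (vrepr G) [ffun v => v] =
  (omega s n k)@_G * (iso_count (vrepr G) (vrepr G) [ffun v => v])%:R.
Proof.
rewrite /weight /iso_pairing pairingE.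
have zero H : H != G -> (iso_count (vrepr H) (vrepr G) [ffun v => v])%:R = 0 :> rat.
  move=> HG; apply/eqP; rewrite pnatr_eq0 -leqn0 leqNgt iso_count_id_same.
  by rewrite vrepr_same.
have [Gsupp|Gsupp] := boolP (G \in msupp (omega s n k)).
  rewrite (big_rem G) //= big1_seq ?addr0 // => H /=.
  by rewrite mem_rem_uniq ?fset_uniq // => /andP[HG _]; rewrite zero ?mulr0.
rewrite big1_seq ?(mcoeff_outdom Gsupp) ?mul0r // => H /= Hsupp.
by rewrite zero ?mulr0 //; apply: contraNneq Gsupp => <-.
Qed.

Lemma omega_sign (n k : nat) (G : vgraph s n) : (0 < n)%N ->
  pos_if (G \in Vconn s n k) ((omega s n k)@_G).
Proof.
move=> n_gt0; rewrite (VconnE _ _ n_gt0).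
have := weight_sign k (vrepr G) (bij_id _); rewrite n_gt0 andbT weight_id.
have iso_gt0 : 0 < (iso_count (vrepr G) (vrepr G) [ffun v => v])%:R :> rat.
  by rewrite ltr0n iso_count_id_same same_up_to_ends_refl.
rewrite /pos_if; case: conn_cyc; first by rewrite pmulr_lgt0.
by rewrite mulf_eq0 (gt_eqF iso_gt0) orbF.
Qed.

Lemma sum_omega_iso (n k : nat) (G : vgraph s n) : (0 < n)%N -> G \in Vconn s n k ->
  \sum_(H <- msupp (omega s n k) | viso H G) (omega s n k)@_H = (vsym G)%:R^-1.
Proof.
move=> n_gt0 Gconn.
have sym_neq0 : (vsym G)%:R != 0 :> rat.
  rewrite pnatr_eq0 -lt0n; apply/card_gt0P.
  by exists ([ffun v => v], [ffun x => x]); rewrite inE is_iso_refl.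
apply: (mulIf sym_neq0); rewrite mulVf //.
rewrite -[RHS](@weight_sum n k _ _ (vrepr G)) ?card_ord -?VconnE //.
under [RHS]eq_bigr do rewrite /weight /iso_pairing pairingE.
rewrite [RHS]exchange_big /= mulr_suml big_mkcond; apply: eq_bigr => H _.
rewrite -mulr_sumr -natr_sum card_isos /viso /vsym.
by case: ifP => _; rewrite ?mulr0.
Qed.

End Main.

Theorem theorem6 (s n k : nat) (n_gt0 : (0 < n)%N) :
  exists (W : {fset vgraph s n}) (alpha : vgraph s n -> rat),
    [/\ W =i Vconn s n k,
        omega s n k = \sum_(G <- W) alpha G *: << G >>,
        forall G : vgraph s n, G \in Vconn s n k -> 0 < alpha G
      & forall C : {pred vgraph s n},
          is_iso_class C -> {subset C <= Vconn s n k} ->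
          forall G : vgraph s n, G \in C ->
            \sum_(H <- W | H \in C) alpha H = (vsym G)%:R^-1].
Proof.
exists (msupp (omega s n k)), (fun G => (omega s n k)@_G); split.
- move=> G; rewrite -mcoeff_neq0; have := omega_sign k G n_gt0.
  by rewrite /pos_if; case: ifP => _; [move/lt0r_neq0 | move=> ->].
- rewrite [LHS]monalgE; apply: eq_bigr => G _; apply/malgP => H.
  by rewrite mcoeffZ !mcoeffU mulrnAr mulr1.
- by move=> G Gconn; have := omega_sign k G n_gt0; rewrite Gconn.
move=> C [G0 CE] Csub G GC; rewrite -(sum_omega_iso n_gt0 (Csub G GC)).
have := GC; rewrite CE => G0G; apply: eq_bigl => H; rewrite CE.
apply/idP/idP => [G0H|HG].
  exact: isomorphic_trans (isomorphic_sym G0H) G0G.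
exact: isomorphic_trans G0G (isomorphic_sym HG).
Qed.
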